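(* Let $(z,z',w,w')$ be admissible and $N\ge1$. There exists a Feller semigroup on $\Omega_N$ whose generator is the operator $D_{z,z',w,w'\mid N}$ with domain $$\{f\in C_0(\Omega_N): D_{z,z',w,w'\mid N}f\in C_0(\Omega_N)\}.$$
   Context: State space and the difference operator: - $\Omega_N=\{\mathbf n=(n_1,\dots,n_N)\in\mathbb Z^N: n_1>n_2>\dots>n_N\}$, a discrete space. - $V(\mathbf n)=\prod_{1\le i<j\le N}(n_i-n_j)$, and $\epsilon_k$ is the $k$th standard basis vector of $\mathbb Z^N$. - For a function $f$ on $\Omega_N$, $$(D_{z,z',w,w'\mid N}f)(\mathbf n)=\sum_{k=1}^N\Big(\frac{V(\mathbf n+\epsilon_k)}{V(\mathbf n)}(z+N-1-n_k)(z'+N-1-n_k)\,(f(\mathbf n+\epsilon_k)-f(\mathbf n))+\frac{V(\mathbf n-\epsilon_k)}{V(\mathbf n)}(w+n_k)(w'+n_k)\,(f(\mathbf n-\epsilon_k)-f(\mathbf n))\Big).$$ - This is well defined, since $V(\mathbf n\pm\epsilon_k)=0$ whenever $\mathbf n\pm\epsilon_k\notin\Omega_N$; it annihilates constants. Admissibility: $(z,z',w,w')\in\mathbb C^4$ is admissible if both of the following hold: - $(z+k)(z'+k)>0$ and $(w+k)(w'+k)>0$ for all $k\in\mathbb Z$; - $\mathrm{Re}(z+z'+w+w')>-1$. Feller semigroups: for a locally compact space $X$, $C_0(X)$ is the Banach space of real continuous functions vanishing at infinity with the sup norm. A Feller semigroup is a strongly continuous semigroup $P(t)$, $t\ge0$,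 on $C_0(X)$ given by Markov (probability) kernels. Its generator is $Af=\lim_{t\to+0}(P(t)f-f)/t$, on the set of $f$ where the limit exists in norm. *)

(* Defs.v *)
From Stdlib Require Import Reals Lra ZArith List.
Open Scope R_scope.

Record Cx := mkCx { Re : R; Im : R }.
Definition cadd (a b : Cx) : Cx := mkCx (Re a + Re b) (Im a + Im b).
Definition cmul (a b : Cx) : Cx :=
  mkCx (Re a * Re b - Im a * Im b) (Re a * Im b + Im a * Re b).
Definition cofR (r : R) : Cx := mkCx r 0.

Definition cpos (c : Cx) : Prop := Im c = 0 /\ Re c > 0.

Definition admissible (z z' w w' : Cx) : Prop :=
  (forall k : Z, cpos (cmul (cadd z (cofR (IZR k))) (cadd z' (cofR (IZR k)))) /\
                 cpos (cmul (cadd w (cofR (IZR k))) (cadd w' (cofR (IZR k))))) /\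
  Re (cadd (cadd z z') (cadd w w')) > -1.

(* the (real, by admissibility) value of (a + m)(b + m) *)
Definition coefq (a b : Cx) (m : Z) : R :=
  Re (cmul (cadd a (cofR (IZR m))) (cadd b (cofR (IZR m)))).

(* points are lists (n_1,...,n_N) (index i of the list = coordinate i+1) *)
Fixpoint strict_decr (l : list Z) : bool :=
  match l with
  | a :: ((b :: _) as t) => Z.gtb a b && strict_decr t
  | _ => true
  end.

Definition is_omega (N : nat) (l : list Z) : bool :=
  Nat.eqb (length l) N && strict_decr l.

Definition Omega (N : nat) : Type := { l : list Z | is_omega N l = true }.

Definition fsum (n : nat) (F : nat -> R) : R :=
  fold_right Rplus 0 (map F (seq 0 n)).

Definition fprod (n : nat) (F : nat -> R) : R :=
  fold_right Rmult 1 (map F (seq 0 n)).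
Definition Vand (l : list Z) : R :=
  fprod (length l) (fun i =>
    fprod (length l) (fun j =>
      if Nat.ltb i j then IZR (nth i l 0%Z - nth j l 0%Z) else 1)).

Definition shiftk (l : list Z) (k : nat) (d : Z) : list Z :=
  map (fun i => if Nat.eqb i k then (nth i l 0%Z + d)%Z else nth i l 0%Z)
      (seq 0 (length l)).

(* extension of a function on Omega_N by 0 to all lists (only used where
   it gets multiplied by a vanishing Vandermonde ratio) *)
Definition ext {N : nat} (f : Omega N -> R) (l : list Z) : R :=
  (match is_omega N l as b return is_omega N l = b -> R with
   | true => fun H => f (exist _ l H)
   | false => fun _ => 0
   end) eq_refl.

Definition Dop (z z' w w' : Cx) (N : nat) (f : Omega N -> R) (x : Omega N) : R :=
  let l := proj1_sig x in
  fsum N (fun k =>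
    Vand (shiftk l k 1) / Vand l
      * coefq z z' (Z.of_nat N - 1 - nth k l 0%Z)
      * (ext f (shiftk l k 1) - f x)
    + Vand (shiftk l k (-1)) / Vand l
      * coefq w w' (nth k l 0%Z)
      * (ext f (shiftk l k (-1)) - f x)).

(* Omega_N is discrete: compact sets are finite, every function is continuous. *)
Definition C0 {N : nat} (f : Omega N -> R) : Prop :=
  forall eps, eps > 0 ->
    exists K : list (Omega N), forall x, ~ In x K -> Rabs (f x) < eps.

Definition has_sum {N : nat} (a : Omega N -> R) (S : R) : Prop :=
  forall eps, eps > 0 ->
    exists K : list (Omega N),
      forall L : list (Omega N), NoDup L -> incl K L ->
        Rabs (fold_right Rplus 0 (map a L) - S) < eps.

Definition feller_semigroup {N : nat}
  (p : R -> Omega N -> Omega N -> R)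
  (T : R -> (Omega N -> R) -> (Omega N -> R)) : Prop :=
  (forall t x y, 0 <= t -> 0 <= p t x y) /\
  (forall t x, 0 <= t -> has_sum (p t x) 1) /\
  (forall t f x, 0 <= t -> C0 f -> has_sum (fun y => p t x y * f y) (T t f x)) /\
  (forall t f, 0 <= t -> C0 f -> C0 (T t f)) /\
  (forall f x, C0 f -> T 0 f x = f x) /\
  (forall s t f x, 0 <= s -> 0 <= t -> C0 f -> T (s + t) f x = T s (T t f) x) /\
  (forall f, C0 f -> forall eps, eps > 0 ->
     exists delta, delta > 0 /\
       forall t, 0 <= t < delta -> forall x, Rabs (T t f x - f x) <= eps).

Definition generator {N : nat} (T : R -> (Omega N -> R) -> (Omega N -> R))
  (f g : Omega N -> R) : Prop :=
  C0 f /\ C0 g /\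
  forall eps, eps > 0 -> exists delta, delta > 0 /\
    forall t, 0 < t < delta -> forall x,
      Rabs ((T t f x - f x) / t - g x) <= eps.

(* Main.v *)
Require Import Defs.
From Stdlib Require Import Reals ZArith List Lra Lia Psatz.
From Stdlib Require Import Classical ClassicalEpsilon FunctionalExtensionality.
Open Scope R_scope.

(** Put psi(n) = 1 + n_1^2 + ... + n_N^2. The jump rates of D grow quadratically, and although
    a single coordinate may be repelled by its neighbours at a quadratic rate, these repulsions
    cancel in the sum over the coordinates, so that |D psi| <= C psi; this is a Lagrange
    interpolation identity for V(n + e_k)/V(n) = prod_(j <> k) (1 + 1/(n_k - n_j)). Hence
    D psi <= c psi and D (1/psi) <= c/psi.

    On the domain {f in C_0 : D f in C_0} the maximum principle makes 1 - h D injective with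
    contractive inverse J_h. For g >= 0 in C_0 the minimal nonnegative solution of f - h D f = g
    lies below eps + C/psi for every eps > 0 and a suitable C, hence is in C_0, so J_h is
    defined on all of C_0. The semigroup is T(t) = lim_m J_(h_m)^(floor(t/h_m)), h_m = h_0/2^m: the
    limit exists because |J_h f - J_(h/2)^2 f| <= h^2/4 |D^2 f| and because finitely supported
    functions, which D preserves, are dense. The generator extends D, and it cannot be a proper
    extension because 1 - h_0 D is onto. Finally, D psi <= c psi prevents loss of mass. *)

(** The rates are unbounded, so the fixed-point map of 1 - h D need not be a uniform contraction.
    Nonnegativity of the rates replaces contraction: monotone iteration gives a solution, and
    comparison with explicit supersolutions gives its size. The bound |D psi| <= C psi has to be
    two-sided. The upper half keeps the chain from escaping to infinity in finite time. The lower
    half keeps it from arriving from infinity in finite time; without such control the minimal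
    solution would be bounded but might fail to vanish at infinity. The lower half enters D (1/psi)
    <= c/psi through a second-order expansion of 1/y around psi(n); the quadratic term of that
    expansion is harmless because the rates and the squared increments of psi are each O(psi). The
    steps h_m do not depend on t, unlike t/n in the usual exponential formula. Hence approximations
    at times s and t are powers of the same operator, and they compose to the one at s + t up to a
    single step; halving makes consecutive approximations comparable with geometrically decreasing
    errors. *)

(** * Uniform distance and elementary tools *)

Definition close {E : Type} (f g : E -> R) (e : R) : Prop :=
  forall x, Rabs (f x - g x) <= e.

Lemma close_sym {E : Type} (f g : E -> R) e : close f g e -> close g f e.
Proof. intros H x. rewrite Rabs_minus_sym. apply H. Qed.

Lemma close_trans {E : Type} (f g h : E -> R) d e :
  close f g d -> close g h e -> close f h (d + e).
Proof.
  intros H1 H2 x.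
  replace (f x - h x) with ((f x - g x) + (g x - h x)) by ring.
  eapply Rle_trans; [apply Rabs_triang|].
  apply Rplus_le_compat; auto.
Qed.

Lemma close_le {E : Type} (f g : E -> R) d e :
  close f g d -> d <= e -> close f g e.
Proof. intros H Hd x. eapply Rle_trans; [apply H|exact Hd]. Qed.

Lemma close_refl {E : Type} (f : E -> R) e : 0 <= e -> close f f e.
Proof. intros He x. rewrite Rminus_diag, Rabs_R0. exact He. Qed.

Lemma Un_cv_const (r : R) : Un_cv (fun _ => r) r.
Proof.
  intros eps He. exists 0%nat. intros n _. unfold Rdist.
  rewrite Rminus_diag, Rabs_R0. exact He.
Qed.

Lemma Rabs_le_bounds x b : Rabs x <= b -> - b <= x <= b.
Proof. unfold Rabs. destruct Rcase_abs; lra. Qed.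

Definition floor_nat (r : R) : nat := Z.to_nat (Int_part r).

Lemma floor_nat_spec r : 0 <= r -> INR (floor_nat r) <= r < INR (floor_nat r) + 1.
Proof.
  intros Hr. destruct (base_Int_part r) as [H1 H2]. unfold floor_nat.
  rewrite INR_IZR_INZ, Z2Nat.id; [lra|].
  assert (-1 < Int_part r)%Z; [apply lt_IZR; lra|lia].
Qed.

(** The base point [x0] covers the empty list and transfers a strict sign of [v x0] to the minimum.
    Maxima are obtained by negating [v]. *)
Lemma list_argmin {E : Type} (v : E -> R) (x0 : E) (K : list E) :
  exists x1, v x1 <= v x0 /\ forall y, In y K -> v x1 <= v y.
Proof.
  induction K as [|b K [x1 [H0 H1]]].
  - exists x0. split; [lra|intros y []].
  - destruct (Rle_dec (v x1) (v b)) as [Hb|Hb].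
    + exists x1. split; [exact H0|]. intros y [<-|Hy]; auto.
    + exists b. split; [lra|]. intros y [<-|Hy]; [lra|].
      specialize (H1 y Hy). lra.
Qed.

(** * Functions vanishing at infinity *)

Section Vanishing.
Context {N : nat}.
Implicit Types f g : Omega N -> R.

(** The dominating [g] may depend on [eps]; this is the shape of the bound eps + C/psi, where C
    grows as eps decreases. *)
Lemma C0_dominated f :
  (forall eps, eps > 0 -> exists g, C0 g /\ forall x, Rabs (f x) <= eps + Rabs (g x)) ->
  C0 f.
Proof.
  intros H eps He.
  destruct (H (eps / 2) ltac:(lra)) as [g [Hg Hfg]].
  destruct (Hg (eps / 2) ltac:(lra)) as [K HK].
  exists K. intros x Hx. specialize (HK x Hx). specialize (Hfg x). lra.
Qed.

Lemma C0_closed f : (forall eps, eps > 0 -> exists g, C0 g /\ close f g eps) -> C0 f.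
Proof.
  intros H. apply C0_dominated. intros eps He.
  destruct (H eps He) as [g [Hg Hc]]. exists g. split; [exact Hg|].
  intros x. specialize (Hc x).
  generalize (Rabs_triang (f x - g x) (g x)).
  replace (f x - g x + g x) with (f x) by ring. lra.
Qed.

Lemma C0_plus f g : C0 f -> C0 g -> C0 (fun x => f x + g x).
Proof.
  intros Hf Hg eps He.
  destruct (Hf (eps / 2) ltac:(lra)) as [K HK].
  destruct (Hg (eps / 2) ltac:(lra)) as [L HL].
  exists (K ++ L). intros x Hx.
  assert (~ In x K /\ ~ In x L) as [HxK HxL]
    by (split; intro; apply Hx, in_or_app; auto).
  specialize (HK x HxK). specialize (HL x HxL).
  generalize (Rabs_triang (f x) (g x)). lra.
Qed.

Lemma C0_scal a f : C0 f -> C0 (fun x => a * f x).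
Proof.
  intros Hf eps He.
  destruct (Hf (eps / (Rabs a + 1))) as [K HK].
  { apply Rdiv_lt_0_compat; [lra|]. generalize (Rabs_pos a). lra. }
  exists K. intros x Hx. specialize (HK x Hx).
  pose proof (Rabs_pos a). rewrite Rabs_mult.
  apply Rle_lt_trans with ((Rabs a + 1) * Rabs (f x)).
  - generalize (Rabs_pos (f x)). nra.
  - apply Rmult_lt_compat_l with (r := Rabs a + 1) in HK; [|lra].
    replace ((Rabs a + 1) * (eps / (Rabs a + 1))) with eps in HK by (field; lra).
    exact HK.
Qed.

Lemma C0_lin a b f g : C0 f -> C0 g -> C0 (fun x => a * f x + b * g x).
Proof. intros Hf Hg. apply C0_plus; apply C0_scal; assumption. Qed.

(** If [f y] is nonzero, then [|f|] stays below [|f y|] off a finite set, so the maximum is taken on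
    that set together with [y]. The zero function is separate, since no positive level is available
    there. *)
Lemma C0_argmax f (x0 : Omega N) : C0 f -> exists x1, forall x, Rabs (f x) <= Rabs (f x1).
Proof.
  intros Hf.
  destruct (classic (forall x, Rabs (f x) = 0)) as [H0|H0].
  { exists x0. intros x. rewrite (H0 x), (H0 x0). lra. }
  apply not_all_ex_not in H0. destruct H0 as [y Hy].
  assert (Hy' : Rabs (f y) > 0).
  { destruct (Rabs_pos (f y)) as [H|H]; [exact H|congruence]. }
  destruct (Hf _ Hy') as [K HK].
  destruct (list_argmin (fun x => - Rabs (f x)) y K) as [x1 [H1 H2]].
  exists x1. intros x. destruct (classic (In x K)) as [Hx|Hx].
  - specialize (H2 x Hx). simpl in H2. lra.
  - specialize (HK x Hx). lra.
Qed.

Lemma C0_bounded f : C0 f -> exists M, 0 <= M /\ forall x, Rabs (f x) <= M.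
Proof.
  intros Hf.
  destruct (classic (exists x : Omega N, True)) as [[x0 _]|He].
  - destruct (C0_argmax f x0 Hf) as [x1 H1].
    exists (Rabs (f x1)). split; [apply Rabs_pos|exact H1].
  - exists 0. split; [lra|]. intros x. exfalso. apply He. exists x. exact I.
Qed.

Lemma C0_finite_support f (K : list (Omega N)) :
  (forall x, ~ In x K -> f x = 0) -> C0 f.
Proof.
  intros H eps He. exists K. intros x Hx. rewrite (H x Hx), Rabs_R0. exact He.
Qed.

End Vanishing.

(** * Jump operators *)

Section JumpOperator.
Context {E : Type} (Q : E -> list (R * E)).
Implicit Types f g : E -> R.

(** [Q x] lists the jumps out of [x] with their rates. Repeated targets add up and jumps from [x] to
    itself contribute nothing, so the list needs no normal form. *)
Definition jump_op f (x : E) : R :=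
  fold_right (fun p s => fst p * (f (snd p) - f x) + s) 0 (Q x).

Lemma jump_op_lin a b f g x :
  jump_op (fun y => a * f y + b * g y) x = a * jump_op f x + b * jump_op g x.
Proof.
  unfold jump_op. induction (Q x) as [|p l IH]; simpl; [ring|].
  rewrite IH. ring.
Qed.

Lemma jump_op_affine a b f x : jump_op (fun y => a + b * f y) x = b * jump_op f x.
Proof.
  unfold jump_op. induction (Q x) as [|p l IH]; simpl; [ring|].
  rewrite IH. ring.
Qed.

Lemma jump_op_cv (F : nat -> E -> R) f x :
  (forall y, Un_cv (fun n => F n y) (f y)) ->
  Un_cv (fun n => jump_op (F n) x) (jump_op f x).
Proof.
  intros H. unfold jump_op. induction (Q x) as [|p l IH]; simpl.
  - apply Un_cv_const.
  - apply CV_plus; [|exact IH].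
    apply CV_mult with (An := fun _ => fst p).
    + apply Un_cv_const.
    + apply CV_minus; apply H.
Qed.

Context (Q_pos : forall x p, In p (Q x) -> 0 <= fst p).

Lemma jump_op_at_min f x : (forall y, f x <= f y) -> 0 <= jump_op f x.
Proof.
  intros H. unfold jump_op. generalize (Q_pos x).
  induction (Q x) as [|p l IH]; simpl; intros Hp; [lra|].
  specialize (IH (fun q Hq => Hp q (or_intror Hq))).
  specialize (Hp p (or_introl eq_refl)). specialize (H (snd p)). nra.
Qed.

Definition exit_rate (x : E) : R := fold_right (fun p s => fst p + s) 0 (Q x).
Definition weighted f (x : E) : R :=
  fold_right (fun p s => fst p * f (snd p) + s) 0 (Q x).

Lemma jump_op_split f x : jump_op f x = weighted f x - exit_rate x * f x.
Proof.
  unfold jump_op, weighted, exit_rate. induction (Q x) as [|p l IH]; simpl; [ring|].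
  rewrite IH. ring.
Qed.

Lemma exit_rate_pos x : 0 <= exit_rate x.
Proof.
  unfold exit_rate. generalize (Q_pos x). induction (Q x) as [|p l IH]; simpl; intros Hp; [lra|].
  specialize (IH (fun q Hq => Hp q (or_intror Hq))).
  specialize (Hp p (or_introl eq_refl)). lra.
Qed.

Lemma weighted_mono f g x : (forall y, f y <= g y) -> weighted f x <= weighted g x.
Proof.
  intros H. unfold weighted. generalize (Q_pos x).
  induction (Q x) as [|p l IH]; simpl; intros Hp; [lra|].
  specialize (IH (fun q Hq => Hp q (or_intror Hq))).
  specialize (Hp p (or_introl eq_refl)). specialize (H (snd p)). nra.
Qed.

Context (h : R) (h_pos : 0 < h) (g : E -> R) (g_pos : forall x, 0 <= g x).

(** Solving [f - h * jump_op f = g] for the diagonal term gives (1 + h q) f = g + h W f, with q the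
    exit rate and W the weighted sum over targets. The right-hand side is monotone in f because the
    rates are nonnegative. *)
Definition picard_step f (x : E) : R :=
  (g x + h * weighted f x) / (1 + h * exit_rate x).

Lemma picard_step_denom x : 0 < 1 + h * exit_rate x.
Proof. generalize (exit_rate_pos x). nra. Qed.

Lemma picard_step_mono f1 f2 x :
  (forall y, f1 y <= f2 y) -> picard_step f1 x <= picard_step f2 x.
Proof.
  intros H. unfold picard_step, Rdiv. apply Rmult_le_compat_r.
  - left. apply Rinv_0_lt_compat, picard_step_denom.
  - generalize (weighted_mono f1 f2 x H). nra.
Qed.

Lemma picard_step_super u x :
  g x <= u x - h * jump_op u x -> picard_step u x <= u x.
Proof.
  intros H. rewrite jump_op_split in H. unfold picard_step.
  pose proof (picard_step_denom x) as Hd.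
  apply Rmult_le_reg_r with (1 + h * exit_rate x); [exact Hd|].
  unfold Rdiv. rewrite Rmult_assoc, Rinv_l; lra.
Qed.

Lemma picard_step_fix f x :
  f x = picard_step f x -> f x - h * jump_op f x = g x.
Proof.
  intros H. rewrite jump_op_split. pose proof (picard_step_denom x) as Hd.
  assert (f x * (1 + h * exit_rate x) = g x + h * weighted f x).
  { rewrite H at 1. unfold picard_step. field. lra. }
  lra.
Qed.

Definition picard_iter (n : nat) : E -> R := Nat.iter n picard_step (fun _ => 0).

Lemma picard_iter_le_super u n x :
  (forall y, 0 <= u y) -> (forall y, g y <= u y - h * jump_op u y) ->
  picard_iter n x <= u x.
Proof.
  intros Hu Hs. revert x. induction n as [|n IH]; intros x; [apply Hu|].
  eapply Rle_trans; [|apply picard_step_super, Hs].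
  apply picard_step_mono, IH.
Qed.

(** The first iterate dominates the zero function because [g] is nonnegative; monotonicity of the
    step propagates this. *)
Lemma picard_iter_growing x : Un_growing (fun n => picard_iter n x).
Proof.
  intros n. revert x. induction n as [|n IH]; intros x.
  - unfold picard_iter; simpl. unfold picard_step, Rdiv.
    apply Rmult_le_pos.
    + assert (0 <= weighted (fun _ => 0) x).
      { unfold weighted. induction (Q x); simpl; lra. }
      generalize (g_pos x). nra.
    + left. apply Rinv_0_lt_compat, picard_step_denom.
  - apply (picard_step_mono (picard_iter n) (picard_iter (S n))), IH.
Qed.

(* The minimal nonnegative solution of [f - h (jump_op f) = g] is the limit of
   Picard iterates; it lies below every nonnegative supersolution. *)
Lemma minimal_solution u0 :
  (forall y, 0 <= u0 y) -> (forall y, g y <= u0 y - h * jump_op u0 y) ->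
  exists f, (forall x, 0 <= f x) /\ (forall x, f x - h * jump_op f x = g x) /\
    forall u, (forall y, 0 <= u y) -> (forall y, g y <= u y - h * jump_op u y) ->
      forall x, f x <= u x.
Proof.
  intros Hu0 Hs0.
  assert (Hcv : forall x, { l | Un_cv (fun n => picard_iter n x) l }).
  { intros x. apply growing_cv; [apply picard_iter_growing|].
    exists (u0 x). intros r [n ->]. apply picard_iter_le_super; assumption. }
  set (f := fun x => proj1_sig (Hcv x)).
  assert (Hf : forall x, Un_cv (fun n => picard_iter n x) (f x))
    by (intros x; exact (proj2_sig (Hcv x))).
  exists f. split; [|split].
  - intros x. apply (growing_ineq _ _ (picard_iter_growing x) (Hf x) 0%nat).
  - intros x.
    apply picard_step_fix.
    apply (UL_sequence (fun n => picard_iter (S n) x)).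
    + intros eps He. destruct (Hf x eps He) as [n0 Hn0].
      exists n0. intros n Hn. apply Hn0. lia.
    + assert (Hw : Un_cv (fun n => weighted (picard_iter n) x) (weighted f x)).
      { replace (weighted f x) with (jump_op f x + exit_rate x * f x)
          by (rewrite jump_op_split; ring).
        apply Un_cv_ext with
          (fun n => jump_op (picard_iter n) x + exit_rate x * picard_iter n x).
        { intros n. rewrite jump_op_split. ring. }
        apply CV_plus; [apply jump_op_cv, Hf|].
        apply CV_mult with (An := fun _ => exit_rate x); [|apply Hf].
        apply Un_cv_const. }
      unfold picard_step.
      apply Un_cv_ext with
        (fun n => (g x + h * weighted (picard_iter n) x) * / (1 + h * exit_rate x)).
      { intros n. reflexivity. }
      apply CV_mult with (Bn := fun _ => / (1 + h * exit_rate x)); [|apply Un_cv_const].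
      apply CV_plus with (An := fun _ => g x); [apply Un_cv_const|].
      apply CV_mult with (An := fun _ => h); [apply Un_cv_const|exact Hw].
  - intros u Hu Hs x. apply Rle_cv_lim with (Un := fun n => picard_iter n x) (Vn := fun _ => u x).
    + intros n. apply picard_iter_le_super; assumption.
    + apply Hf.
    + apply Un_cv_const.
Qed.

End JumpOperator.

(** * Feller semigroups from a Lyapunov function *)

Section Resolvent.
Context {N : nat} (Q : Omega N -> list (R * Omega N)).
Context (Q_pos : forall x p, In p (Q x) -> 0 <= fst p).
Context (psi : Omega N -> R) (a c : R).
Context (psi_ge1 : forall x, 1 <= psi x).
Context (psi_proper : forall M, exists K : list (Omega N), forall x, psi x <= M -> In x K).
Context (c_pos : 0 <= c).
Context (psi_super : forall x, jump_op Q psi x <= c * psi x).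
Context (inv_super : forall x, jump_op Q (fun y => / psi y) x <= c * / psi x).
(** From a point with large [psi] every jump lands where [psi] is still large. This is what makes
    [D] preserve finite support. *)
Context (psi_jump : forall x p, In p (Q x) -> psi x <= a * psi (snd p)).
Implicit Types f g v : Omega N -> R.
Local Notation D := (jump_op Q).

(** * Minimum principle and finitely supported functions *)

(** At a negative minimum [D v] is nonnegative, so [v - h * D v] would be negative there. At
    infinity only a lower bound is asked, so that functions with a positive limit, or tending to
    infinity like [psi], are covered. *)
Lemma nonneg_of_min_principle v h :
  0 <= h -> (forall eps, eps > 0 -> exists K : list (Omega N), forall x, ~ In x K -> - eps < v x) ->
  (forall x, 0 <= v x - h * D v x) -> forall x, 0 <= v x.
Proof.
  intros Hh Hinf Hv x. destruct (Rle_dec 0 (v x)) as [|Hx]; [assumption|exfalso].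
  destruct (Hinf (- v x) ltac:(lra)) as [K HK].
  destruct (list_argmin v x K) as [x1 [H1 H2]].
  assert (Hmin : forall y, v x1 <= v y).
  { intros y. destruct (classic (In y K)) as [Hy|Hy]; [auto|].
    specialize (HK y Hy). lra. }
  pose proof (jump_op_at_min Q Q_pos v x1 Hmin). specialize (Hv x1). nra.
Qed.

(** The minimum principle applies to B + (f - g) and B - (f - g), both of which tend to B >= 0 at
    infinity. *)
Lemma dissipative f g h B :
  0 <= h -> C0 f -> C0 g -> close (fun x => f x - h * D f x) (fun x => g x - h * D g x) B ->
  close f g B.
Proof.
  intros Hh Hf Hg HB.
  assert (key : forall s, s = 1 \/ s = -1 -> forall x, 0 <= B + s * (f x - g x)).
  { intros s Hs x.
    apply (nonneg_of_min_principle (fun x => B + s * (f x - g x)) h Hh).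
    - intros eps He.
      assert (Hd : C0 (fun x => 1 * f x + (-1) * g x)) by (apply C0_lin; assumption).
      destruct (Hd eps He) as [K HK]. exists K. intros y Hy. specialize (HK y Hy).
      assert (0 <= B) by (eapply Rle_trans; [apply Rabs_pos|exact (HB y)]).
      apply Rabs_def2 in HK. destruct Hs; subst s; lra.
    - intros y. rewrite jump_op_affine.
      replace (fun x => f x - g x) with (fun x => 1 * f x + (-1) * g x)
        by (extensionality u; ring).
      rewrite jump_op_lin.
      specialize (HB y). apply Rabs_le_bounds in HB. simpl in HB.
      destruct Hs; subst s; lra. }
  intros x. apply Rabs_le.
  generalize (key 1 ltac:(auto) x) (key (-1) ltac:(auto) x). lra.
Qed.

(** Sublevel sets of [psi] are finite, and every finite set lies in one of them, so they may replace
    finite sets as neighbourhoods of infinity. *)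
Lemma C0_iff_psi f :
  C0 f <-> forall eps, eps > 0 -> exists M, forall x, M < psi x -> Rabs (f x) < eps.
Proof.
  split; intros H eps He; destruct (H eps He) as [K HK].
  - destruct K as [|y K].
    { exists 0. intros x _. apply HK. intros []. }
    destruct (list_argmin (fun x => - psi x) y (y :: K)) as [x1 [_ H1]].
    exists (psi x1). intros x Hx. apply HK. intros Hin.
    specialize (H1 x Hin). simpl in H1. lra.
  - destruct (psi_proper K) as [L HL]. exists L. intros x Hx. apply HK.
    destruct (Rlt_dec K (psi x)); [assumption|]. exfalso. apply Hx, HL. lra.
Qed.

Definition finsupp f : Prop := exists M, forall x, M < psi x -> f x = 0.

Lemma finsupp_C0 f : finsupp f -> C0 f.
Proof.
  intros [M HM]. apply C0_iff_psi. intros eps He. exists M. intros x Hx.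
  rewrite (HM x Hx), Rabs_R0. exact He.
Qed.

Lemma finsupp_D f : finsupp f -> finsupp (D f).
Proof.
  (* Above this level a jump cannot land in the set where [psi] is at most [M]. The absolute value
     of [a] and the maximum with 0 avoid sign assumptions on [a] and [M]. *)
  intros [M HM]. exists (Rmax M (Rabs a * Rmax M 0)). intros x Hx.
  assert (HfX : f x = 0).
  { apply HM. eapply Rle_lt_trans; [apply Rmax_l|exact Hx]. }
  assert (Hf : forall p, In p (Q x) -> f (snd p) = 0).
  { intros p Hp. apply HM. specialize (psi_jump x p Hp).
    assert (Rabs a * Rmax M 0 < psi x) by (eapply Rle_lt_trans; [apply Rmax_r|exact Hx]).
    pose proof (Rle_abs a). pose proof (psi_ge1 (snd p)). pose proof (psi_ge1 x).
    pose proof (Rmax_l M 0). pose proof (Rmax_r M 0).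
    destruct (Rlt_dec M (psi (snd p))) as [|Hn]; [assumption|exfalso].
    assert (psi (snd p) <= Rmax M 0) by lra.
    assert (a * psi (snd p) <= Rabs a * psi (snd p)) by (apply Rmult_le_compat_r; lra).
    assert (Rabs a * psi (snd p) <= Rabs a * Rmax M 0)
      by (apply Rmult_le_compat_l; [apply Rabs_pos|lra]).
    lra. }
  unfold jump_op. induction (Q x) as [|p l IH]; simpl; [reflexivity|].
  rewrite IH by (intros q Hq; apply Hf; right; exact Hq).
  rewrite HfX, (Hf p (or_introl eq_refl)). ring.
Qed.

Lemma finsupp_dense f eps : C0 f -> eps > 0 -> exists g, finsupp g /\ close g f eps.
Proof.
  intros Hf He. destruct (proj1 (C0_iff_psi f) Hf eps He) as [M HM].
  exists (fun x => if Rlt_dec M (psi x) then 0 else f x). split.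
  - exists M. intros x Hx. destruct (Rlt_dec M (psi x)); [reflexivity|contradiction].
  - intros x. destruct (Rlt_dec M (psi x)) as [Hx|Hx].
    + specialize (HM x Hx). replace (0 - f x) with (- f x) by ring. rewrite Rabs_Ropp. lra.
    + rewrite Rminus_diag, Rabs_R0. lra.
Qed.

Lemma inv_psi_C0 : C0 (fun x => / psi x).
Proof.
  apply C0_iff_psi. intros eps He. exists (/ eps). intros x Hx.
  pose proof (psi_ge1 x). rewrite Rabs_pos_eq by (left; apply Rinv_0_lt_compat; lra).
  rewrite <- (Rinv_inv eps). apply Rinv_lt_contravar; [|exact Hx].
  apply Rmult_lt_0_compat; [apply Rinv_0_lt_compat; lra|lra].
Qed.

(** * The resolvent *)

(** A constant bound of [g] is a supersolution, so the minimal solution exists; minimality then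
    allows comparison with every eps + C/psi. Since h c <= 1/2, the operator 1 - h D maps 1/psi to
    at least half of itself. *)
Lemma resolvent_exists_nonneg h g :
  0 < h -> h * c <= 1 / 2 -> C0 g -> (forall x, 0 <= g x) ->
  exists f, C0 f /\ forall x, f x - h * D f x = g x.
Proof.
  intros Hh Hhc Hg Hg0.
  destruct (C0_bounded g Hg) as [M [HM HgM]].
  (* The constant [M] is written [M + 0 * 0] to match [jump_op_affine] with zero slope. *)
  destruct (minimal_solution Q Q_pos h Hh g Hg0 (fun _ => M + 0 * 0)) as [f [Hf0 [Hf Hfmin]]].
  - intros _. lra.
  - intros y. rewrite jump_op_affine. specialize (HgM y). apply Rabs_le_bounds in HgM. lra.
  - exists f. split; [|exact Hf].
    apply C0_dominated. intros eps He.
    destruct (proj1 (C0_iff_psi g) Hg eps He) as [L HL].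
    (* Where psi > L the term eps alone exceeds [g]. Where psi <= L this constant makes C/(2 psi) at
       least M, and the factor 2 offsets the half lost to h D (1/psi). *)
    set (C := 2 * M * (Rabs L + 1)).
    assert (HC : 0 <= C).
    { unfold C. pose proof (Rabs_pos L). nra. }
    exists (fun x => C * / psi x). split; [apply C0_scal, inv_psi_C0|].
    intros x. rewrite (Rabs_pos_eq (f x)) by apply Hf0.
    eapply Rle_trans; [|apply Rplus_le_compat_l, Rle_abs].
    apply (Hfmin (fun x => eps + C * / psi x)); intros y;
      pose proof (psi_ge1 y) as Hy; pose proof (Rinv_0_lt_compat (psi y) ltac:(lra)) as Hi.
    + nra.
    + rewrite jump_op_affine. pose proof (inv_super y) as Hs.
      assert (Hs' : h * D (fun y0 => / psi y0) y <= / psi y * / 2).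
      { apply Rle_trans with (h * (c * / psi y)); [apply Rmult_le_compat_l; lra|].
        replace (h * (c * / psi y)) with (/ psi y * (h * c)) by ring.
        apply Rmult_le_compat_l; lra. }
      assert (C * (h * D (fun y0 => / psi y0) y) <= C * (/ psi y * / 2))
        by (apply Rmult_le_compat_l; assumption).
      destruct (Rlt_dec L (psi y)) as [HyL|HyL].
      * specialize (HL y HyL). apply Rabs_def2 in HL. nra.
      * specialize (HgM y). apply Rabs_le_bounds in HgM.
        assert (M <= C * (/ psi y * / 2)).
        { assert (psi y <= Rabs L + 1) by (pose proof (Rle_abs L); lra).
          unfold C. replace (2 * M * (Rabs L + 1) * (/ psi y * / 2))
            with (M * ((Rabs L + 1) * / psi y)) by (field; lra).
          assert (1 <= (Rabs L + 1) * / psi y).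
          { apply Rle_trans with (psi y * / psi y); [right; field; lra|].
            apply Rmult_le_compat_r; lra. }
          nra. }
        nra.
Qed.

Lemma resolvent_exists h g :
  0 < h -> h * c <= 1 / 2 -> C0 g ->
  exists f, C0 f /\ forall x, f x - h * D f x = g x.
Proof.
  intros Hh Hhc Hg.
  (* The signs 1 and -1 produce the positive and the negative part of [g], which are solved for
     separately and subtracted. *)
  assert (Hpart : forall s, s = 1 \/ s = -1 -> exists f, C0 f /\
    forall x, f x - h * D f x = Rmax 0 (s * g x)).
  { intros s Hs. apply resolvent_exists_nonneg; auto.
    - apply C0_dominated. intros eps He. exists g. split; [exact Hg|]. intros x.
      assert (Rabs (Rmax 0 (s * g x)) <= Rabs (g x)); [|lra].
      destruct Hs; subst s; unfold Rmax, Rabs; repeat destruct Rle_dec;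
        repeat destruct Rcase_abs; lra.
    - intros x. apply Rmax_l. }
  destruct (Hpart 1) as [f1 [H1 E1]]; [auto|].
  destruct (Hpart (-1)) as [f2 [H2 E2]]; [auto|].
  exists (fun x => 1 * f1 x + (-1) * f2 x). split; [apply C0_lin; assumption|].
  intros x. rewrite jump_op_lin. specialize (E1 x). specialize (E2 x).
  revert E1 E2. unfold Rmax. repeat destruct Rle_dec; lra.
Qed.

(** Defined by choice for all arguments; it is the inverse of 1 - h D when [small h] and [C0 g]
    hold, and then the solution is unique in [C0]. *)
Definition resolvent (h : R) g : Omega N -> R :=
  epsilon (inhabits (fun _ => 0)) (fun f => C0 f /\ forall x, f x - h * D f x = g x).

Definition small h := 0 < h /\ h * c <= 1 / 2.

Lemma resolvent_spec h g : small h -> C0 g ->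
  C0 (resolvent h g) /\ forall x, resolvent h g x - h * D (resolvent h g) x = g x.
Proof.
  intros [Hh Hhc] Hg. unfold resolvent. apply epsilon_spec, resolvent_exists; assumption.
Qed.

Lemma resolvent_C0 h g : small h -> C0 g -> C0 (resolvent h g).
Proof. intros Hh Hg. apply resolvent_spec; assumption. Qed.

Lemma resolvent_eq h g : small h -> C0 g ->
  forall x, resolvent h g x - h * D (resolvent h g) x = g x.
Proof. intros Hh Hg. apply resolvent_spec; assumption. Qed.

Lemma resolvent_unique h f g : small h -> C0 f -> C0 g ->
  (forall x, f x - h * D f x = g x) -> resolvent h g = f.
Proof.
  intros Hh Hf Hg Hfg. extensionality x.
  assert (H : close (resolvent h g) f 0).
  { apply dissipative with h; auto.
    - destruct Hh; lra.
    - apply resolvent_C0; assumption.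
    - intros y. rewrite resolvent_eq, Hfg, Rminus_diag, Rabs_R0 by assumption. lra. }
  specialize (H x). apply Rabs_le_bounds in H. lra.
Qed.

Lemma resolvent_close h f g e : small h -> C0 f -> C0 g -> close f g e ->
  close (resolvent h f) (resolvent h g) e.
Proof.
  intros Hh Hf Hg Hfg. apply dissipative with h; [destruct Hh; lra| | |].
  1, 2: apply resolvent_C0; assumption.
  intros x. rewrite !resolvent_eq by assumption. apply Hfg.
Qed.

Lemma resolvent_lin h a1 a2 f g : small h -> C0 f -> C0 g ->
  resolvent h (fun x => a1 * f x + a2 * g x) =
  (fun x => a1 * resolvent h f x + a2 * resolvent h g x).
Proof.
  intros Hh Hf Hg. apply resolvent_unique; auto.
  - apply C0_lin; apply resolvent_C0; assumption.
  - apply C0_lin; assumption.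
  - intros x. rewrite jump_op_lin.
    rewrite <- (resolvent_eq h f Hh Hf x), <- (resolvent_eq h g Hh Hg x). ring.
Qed.

Lemma resolvent_nonneg h g : small h -> C0 g -> (forall x, 0 <= g x) ->
  forall x, 0 <= resolvent h g x.
Proof.
  intros Hh Hg Hg0. apply nonneg_of_min_principle with h.
  - destruct Hh; lra.
  - intros eps He. destruct (resolvent_C0 h g Hh Hg eps He) as [K HK].
    exists K. intros x Hx. specialize (HK x Hx). apply Rabs_def2 in HK. lra.
  - intros x. rewrite resolvent_eq by assumption. apply Hg0.
Qed.

(* Minimum principle for [resolvent h g - 1 + s psi], which tends to infinity. *)
Lemma resolvent_ge h g r : small h -> C0 g -> 0 < r ->
  (forall x, 1 - r * psi x <= g x) ->
  forall x, 1 - r / (1 - h * c) * psi x <= resolvent h g x.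
Proof.
  intros Hh Hg Hr H x. assert (Hd : 1 / 2 <= 1 - h * c) by (destruct Hh; lra).
  set (s := r / (1 - h * c)).
  assert (Hs0 : 0 < s) by (apply Rdiv_lt_0_compat; lra).
  assert (Hs : s * (1 - h * c) = r) by (unfold s; field; lra).
  assert (Hnn : 0 <= -1 + 1 * (1 * resolvent h g x + s * psi x)); [|lra].
  apply (nonneg_of_min_principle (fun x => -1 + 1 * (1 * resolvent h g x + s * psi x)) h).
  - destruct Hh; lra.
  - intros eps He. destruct (resolvent_C0 h g Hh Hg eps He) as [K HK].
    destruct (psi_proper (/ s)) as [L HL].
    exists (K ++ L). intros y Hy. rewrite in_app_iff in Hy.
    specialize (HK y (fun i => Hy (or_introl i))). apply Rabs_def2 in HK.
    destruct (Rle_dec (psi y) (/ s)) as [Hle|Hgt]; [exfalso; auto|].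
    assert (1 <= s * psi y); [|lra].
    apply Rle_trans with (s * / s); [right; field; lra|]. apply Rmult_le_compat_l; lra.
  - intros y. rewrite jump_op_affine, jump_op_lin.
    pose proof (resolvent_eq h g Hh Hg y) as E.
    specialize (H y). rewrite <- E in H. destruct Hh as [Hh _].
    assert (s * (h * D psi y) <= s * (h * (c * psi y))).
    { apply Rmult_le_compat_l; [lra|]. apply Rmult_le_compat_l; [lra|apply psi_super]. }
    assert (r * psi y = s * psi y - s * (h * (c * psi y))) by (rewrite <- Hs; ring).
    lra.
Qed.

(** * Iterated resolvents and commutation with D *)

Lemma resolvent_iter_C0 h n g : small h -> C0 g -> C0 (Nat.iter n (resolvent h) g).
Proof. intros Hh Hg. induction n; simpl; [exact Hg|apply resolvent_C0; assumption]. Qed.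

Lemma resolvent_iter_close h n f g e : small h -> C0 f -> C0 g -> close f g e ->
  close (Nat.iter n (resolvent h) f) (Nat.iter n (resolvent h) g) e.
Proof.
  intros Hh Hf Hg H. induction n; simpl; [exact H|].
  apply resolvent_close; auto; apply resolvent_iter_C0; assumption.
Qed.

Lemma resolvent_iter_lin h n a1 a2 f g : small h -> C0 f -> C0 g ->
  Nat.iter n (resolvent h) (fun x => a1 * f x + a2 * g x) =
  (fun x => a1 * Nat.iter n (resolvent h) f x + a2 * Nat.iter n (resolvent h) g x).
Proof.
  intros Hh Hf Hg. induction n; simpl; [reflexivity|].
  rewrite IHn. apply resolvent_lin; auto; apply resolvent_iter_C0; assumption.
Qed.

Lemma resolvent_iter_nonneg h n g : small h -> C0 g -> (forall x, 0 <= g x) ->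
  forall x, 0 <= Nat.iter n (resolvent h) g x.
Proof.
  intros Hh Hg H. induction n; simpl; [exact H|].
  apply resolvent_nonneg; auto; apply resolvent_iter_C0; assumption.
Qed.

Lemma resolvent_iter_ge h n g r : small h -> C0 g -> 0 < r ->
  (forall x, 1 - r * psi x <= g x) ->
  forall x, 1 - r * (/ (1 - h * c)) ^ n * psi x <= Nat.iter n (resolvent h) g x.
Proof.
  intros Hh Hg Hr H. induction n as [|n IH]; intros x.
  - simpl. specialize (H x). lra.
  - simpl Nat.iter.
    replace (r * (/ (1 - h * c)) ^ S n) with (r * (/ (1 - h * c)) ^ n / (1 - h * c))
      by (simpl; unfold Rdiv; ring).
    apply resolvent_ge; auto.
    + apply resolvent_iter_C0; assumption.
    + apply Rmult_lt_0_compat; [exact Hr|]. apply pow_lt, Rinv_0_lt_compat.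
      destruct Hh; lra.
Qed.

Definition dom f := C0 f /\ C0 (D f).

(** Write J for the resolvent. Applying 1 - h D to f + h J (D f) gives f, so J f = f + h J (D f) by
    uniqueness. The resolvent equation itself says J f = f + h D (J f). *)
Lemma resolvent_commute h f : small h -> dom f -> D (resolvent h f) = resolvent h (D f).
Proof.
  intros Hh [Hf HDf].
  assert (E : resolvent h f = fun x => 1 * f x + h * resolvent h (D f) x).
  { apply resolvent_unique; auto.
    - apply C0_lin; [assumption|apply resolvent_C0; assumption].
    - intros x. rewrite jump_op_lin.
      pose proof (resolvent_eq h (D f) Hh HDf x) as Ex.
      apply (f_equal (Rmult h)) in Ex. lra. }
  extensionality x. pose proof (resolvent_eq h f Hh Hf x) as Ex.
  pose proof (f_equal (fun u => u x) E) as E'. simpl in E'. destruct Hh as [Hh _].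
  apply Rmult_eq_reg_l with h; lra.
Qed.

(** The resolvent equation expresses D (J f) as (J f - f)/h, a combination of [C0] functions. *)
Lemma resolvent_dom h f : small h -> C0 f -> dom (resolvent h f).
Proof.
  intros Hh Hf. split; [apply resolvent_C0; assumption|].
  replace (D (resolvent h f)) with (fun x => / h * resolvent h f x + (- / h) * f x).
  - apply C0_lin; [apply resolvent_C0|]; assumption.
  - extensionality x. rewrite <- (resolvent_eq h f Hh Hf x).
    destruct Hh as [Hh _]. field. lra.
Qed.

Lemma resolvent_iter_dom h n f : small h -> dom f -> dom (Nat.iter n (resolvent h) f).
Proof.
  intros Hh Hf. destruct n; simpl; [exact Hf|].
  apply resolvent_dom; auto. apply resolvent_iter_C0; [auto|apply Hf].
Qed.

Lemma resolvent_iter_commute h n f : small h -> dom f ->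
  D (Nat.iter n (resolvent h) f) = Nat.iter n (resolvent h) (D f).
Proof.
  intros Hh Hf. induction n; simpl; [reflexivity|].
  rewrite resolvent_commute, IHn; auto. apply resolvent_iter_dom; assumption.
Qed.

Lemma resolvent_iter_bound h n f M : small h -> C0 f -> (forall x, Rabs (f x) <= M) ->
  forall x, Rabs (Nat.iter n (resolvent h) f x) <= M.
Proof.
  intros Hh Hf HM x.
  assert (H0 : C0 (fun _ : Omega N => 0)) by (apply (C0_finite_support _ nil); auto).
  assert (Hz : Nat.iter n (resolvent h) (fun _ => 0) = fun _ => 0).
  { induction n; simpl; [reflexivity|]. rewrite IHn.
    apply resolvent_unique; auto. intros y.
    replace (fun _ : Omega N => 0) with (fun y : Omega N => 0 + 0 * psi y)
      by (extensionality u; ring).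
    rewrite jump_op_affine. ring. }
  assert (Hc : close f (fun _ => 0) M).
  { intros y. rewrite Rminus_0_r. apply HM. }
  pose proof (resolvent_iter_close h n f _ M Hh Hf H0 Hc x) as H.
  rewrite Hz, Rminus_0_r in H. exact H.
Qed.

Lemma resolvent_near_id h f M : small h -> dom f -> (forall x, Rabs (D f x) <= M) ->
  close (resolvent h f) f (h * M).
Proof.
  intros Hh Hf HM x.
  replace (resolvent h f x - f x) with (h * D (resolvent h f) x)
    by (rewrite <- (resolvent_eq h f Hh (proj1 Hf) x); ring).
  rewrite resolvent_commute by assumption. rewrite Rabs_mult.
  destruct Hf as [_ HDf]. pose proof Hh as [Hp _].
  rewrite (Rabs_pos_eq h) by lra. apply Rmult_le_compat_l; [lra|].
  apply (resolvent_iter_bound h 1 (D f) M Hh HDf HM).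
Qed.

Lemma resolvent_iter_near_id h n f M : small h -> dom f -> (forall x, Rabs (D f x) <= M) ->
  close (Nat.iter n (resolvent h) f) f (INR n * h * M).
Proof.
  intros Hh Hf HM. induction n as [|n IH].
  - simpl. apply close_refl. lra.
  - rewrite S_INR. replace ((INR n + 1) * h * M) with (h * M + INR n * h * M) by ring.
    simpl Nat.iter. eapply close_trans; [|exact IH].
    apply resolvent_near_id; auto.
    + apply resolvent_iter_dom; assumption.
    + rewrite resolvent_iter_commute by assumption.
      apply resolvent_iter_bound; auto. apply Hf.
Qed.

Lemma small_half h : small h -> small (h / 2).
Proof. intros [H1 H2]. split; [lra|]. nra. Qed.

(* [(1 - (h/2) D)^2 = (1 - h D) + (h^2/4) D^2]. *)
Lemma resolvent_halve h f M : small h -> dom f -> dom (D f) ->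
  (forall x, Rabs (D (D f) x) <= M) ->
  close (resolvent h f) (resolvent (h / 2) (resolvent (h / 2) f)) (h * h / 4 * M).
Proof.
  intros Hh Hf HDf HM. pose proof (small_half h Hh) as Hk.
  set (k := h / 2) in *. set (u := resolvent k f). set (v := resolvent k u).
  assert (Hu : dom u) by (apply resolvent_dom; [auto|apply Hf]).
  assert (Hv : dom v) by (apply resolvent_dom; [auto|apply Hu]).
  apply dissipative with h; [destruct Hh; lra|apply resolvent_C0; [auto|apply Hf]|apply Hv|].
  intros x. rewrite resolvent_eq by (auto; apply Hf).
  assert (EDDv : D (D v) = Nat.iter 2 (resolvent k) (D (D f))).
  { change v with (Nat.iter 2 (resolvent k) f). rewrite !resolvent_iter_commute by auto.
    reflexivity. }
  assert (Ev : u = fun y => 1 * v y + (- k) * D v y).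
  { extensionality y. rewrite <- (resolvent_eq k u Hk (proj1 Hu) y). fold v. ring. }
  pose proof (resolvent_eq k f Hk (proj1 Hf) x) as Ef. fold u in Ef.
  rewrite Ev, jump_op_lin, EDDv in Ef.
  replace (f x - (v x - h * D v x)) with (h * h / 4 * Nat.iter 2 (resolvent k) (D (D f)) x).
  2:{ rewrite <- Ef. unfold k. field. }
  rewrite Rabs_mult, (Rabs_pos_eq (h * h / 4)) by nra.
  apply Rmult_le_compat_l; [nra|]. apply resolvent_iter_bound; auto. apply HDf.
Qed.

(** Telescoping: each replacement of one step by two half steps costs the error of
    [resolvent_halve], and contractivity keeps earlier errors from growing. The bound on D^2
    persists along the iteration because D commutes with the resolvents. *)
Lemma resolvent_iter_halve h n f M : small h -> dom f -> dom (D f) ->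
  (forall x, Rabs (D (D f) x) <= M) ->
  close (Nat.iter n (resolvent h) f) (Nat.iter (2 * n) (resolvent (h / 2)) f)
    (INR n * (h * h / 4 * M)).
Proof.
  intros Hh Hf HDf HM. pose proof (small_half h Hh) as Hk.
  induction n as [|n IH]; [simpl; apply close_refl; lra|].
  replace (2 * S n)%nat with (S (S (2 * n))) by lia. rewrite S_INR.
  replace ((INR n + 1) * (h * h / 4 * M)) with (INR n * (h * h / 4 * M) + h * h / 4 * M) by ring.
  set (g := Nat.iter (2 * n) (resolvent (h / 2)) f) in *.
  assert (Hg : dom g) by (apply resolvent_iter_dom; assumption).
  assert (HDg : D g = Nat.iter (2 * n) (resolvent (h / 2)) (D f))
    by (apply resolvent_iter_commute; assumption).
  apply close_trans with (resolvent h g).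
  - apply resolvent_close; auto; [|apply Hg]. apply resolvent_iter_C0; [auto|apply Hf].
  - change (Nat.iter (S (S (2 * n))) (resolvent (h / 2)) f)
      with (resolvent (h / 2) (resolvent (h / 2) g)).
    apply resolvent_halve; auto; rewrite HDg.
    + apply resolvent_iter_dom; assumption.
    + rewrite resolvent_iter_commute by assumption. apply resolvent_iter_bound; auto. apply HDf.
Qed.

(** * The implicit Euler scheme with dyadic steps *)

(** The initial step 1/(2 (c + 1)) satisfies h c <= 1/2 and stays meaningful when c = 0. *)
Definition step (m : nat) : R := / (2 * (c + 1)) * (/ 2) ^ m.

Lemma step_S m : step (S m) = step m / 2.
Proof. unfold step. simpl. field. lra. Qed.

Lemma step_small m : small (step m).
Proof.
  induction m as [|m IH].
  - unfold step, small. simpl. split.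
    + rewrite Rmult_1_r. apply Rinv_0_lt_compat. lra.
    + apply Rmult_le_reg_l with (2 * (c + 1)); [lra|].
      replace (2 * (c + 1) * (/ (2 * (c + 1)) * 1 * c)) with c by (field; lra). lra.
  - rewrite step_S. apply small_half, IH.
Qed.

Lemma step_pos m : 0 < step m.
Proof. apply step_small. Qed.

Lemma step_cv : Un_cv step 0.
Proof.
  replace 0 with (/ (2 * (c + 1)) * 0) by ring.
  apply CV_mult with (An := fun _ => / (2 * (c + 1))) (Bn := fun m => (/ 2) ^ m).
  - apply Un_cv_const.
  - intros eps He. destruct (pow_lt_1_zero (/ 2)) with (y := eps) as [m0 H0]; auto.
    { rewrite Rabs_pos_eq; lra. }
    exists m0. intros n Hn. unfold Rdist. rewrite Rminus_0_r. apply H0. exact Hn.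
Qed.

Definition euler (t : R) (m : nat) f : Omega N -> R :=
  Nat.iter (floor_nat (t / step m)) (resolvent (step m)) f.

Lemma euler_time t m : 0 <= t ->
  INR (floor_nat (t / step m)) * step m <= t < INR (floor_nat (t / step m)) * step m + step m.
Proof.
  intros Ht. pose proof (step_pos m) as Hs.
  destruct (floor_nat_spec (t / step m)) as [H1 H2].
  { unfold Rdiv. apply Rmult_le_pos; [exact Ht|]. left. apply Rinv_0_lt_compat, Hs. }
  apply Rmult_le_compat_r with (r := step m) in H1; [|lra].
  apply Rmult_lt_compat_r with (r := step m) in H2; [|lra].
  replace (t / step m * step m) with t in * by (field; lra). lra.
Qed.

Lemma euler_C0 t m f : C0 f -> C0 (euler t m f).
Proof. apply resolvent_iter_C0, step_small. Qed.

Lemma euler_close t m f g e : C0 f -> C0 g -> close f g e -> close (euler t m f) (euler t m g) e.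
Proof. apply resolvent_iter_close, step_small. Qed.

(** Halving the step turns the number n of steps into 2n or 2n + 1. The halving estimate handles 2n,
    with n h <= t, and a possible additional half step costs at most h/2 times the bound on D f. The
    absolute values spare a proof that [M1] and [M2] are nonnegative. *)
Lemma euler_succ t m f M1 M2 : 0 <= t -> dom f -> dom (D f) ->
  (forall x, Rabs (D f x) <= M1) -> (forall x, Rabs (D (D f) x) <= M2) ->
  close (euler t m f) (euler t (S m) f) ((t * Rabs M2 + Rabs M1) * step m).
Proof.
  intros Ht Hf HDf H1 H2.
  pose proof (euler_time t m Ht) as Hn. pose proof (euler_time t (S m) Ht) as Hn'.
  unfold euler. rewrite step_S in *. set (h := step m) in *.
  set (n := floor_nat (t / h)) in *. set (n' := floor_nat (t / (h / 2))) in *.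
  pose proof (step_small m) as Hh. fold h in Hh. pose proof (small_half h Hh) as Hk.
  assert (Hp : 0 < h) by (destruct Hh; lra).
  assert (Hcase : (n' = 2 * n \/ n' = S (2 * n))%nat).
  { assert (2 * INR n < INR n' + 1) by (apply Rmult_lt_reg_r with (h / 2); lra).
    assert (INR n' < 2 * INR n + 2) by (apply Rmult_lt_reg_r with (h / 2); lra).
    assert (Ha : (2 * n < n' + 1)%nat)
      by (apply INR_lt; rewrite mult_INR, plus_INR; simpl; lra).
    assert (Hb : (n' < 2 * n + 2)%nat)
      by (apply INR_lt; rewrite plus_INR, mult_INR; simpl; lra).
    lia. }
  pose proof (Rabs_pos M1) as P1. pose proof (Rabs_pos M2) as P2.
  pose proof (Rle_abs M1) as Q1. pose proof (Rle_abs M2) as Q2.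
  assert (Hmain : close (Nat.iter n (resolvent h) f) (Nat.iter (2 * n) (resolvent (h / 2)) f)
                    (t * Rabs M2 * h)).
  { eapply close_le; [apply resolvent_iter_halve with (M := Rabs M2); auto|].
    - intros x. specialize (H2 x). lra.
    - replace (INR n * (h * h / 4 * Rabs M2)) with (INR n * h * (h * Rabs M2 / 4)) by field.
      assert (0 <= h * Rabs M2) by (apply Rmult_le_pos; lra).
      assert (INR n * h * (h * Rabs M2 / 4) <= t * (h * Rabs M2 / 4))
        by (apply Rmult_le_compat_r; lra).
      nra. }
  destruct Hcase as [-> | ->].
  - eapply close_le; [exact Hmain|]. nra.
  - replace ((t * Rabs M2 + Rabs M1) * h) with (t * Rabs M2 * h + Rabs M1 * h) by ring.
    eapply close_trans; [exact Hmain|]. apply close_sym.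
    change (Nat.iter (S (2 * n)) (resolvent (h / 2)) f)
      with (resolvent (h / 2) (Nat.iter (2 * n) (resolvent (h / 2)) f)).
    eapply close_le; [apply resolvent_near_id with (M := Rabs M1); auto|].
    + apply resolvent_iter_dom; assumption.
    + rewrite resolvent_iter_commute by assumption. apply resolvent_iter_bound; auto; [apply Hf|].
      intros x. specialize (H1 x). lra.
    + nra.
Qed.

(** The successive errors form a geometric series of ratio 1/2, whence the factor 2. *)
Lemma euler_tail t m p f M1 M2 : 0 <= t -> dom f -> dom (D f) ->
  (forall x, Rabs (D f x) <= M1) -> (forall x, Rabs (D (D f) x) <= M2) ->
  close (euler t m f) (euler t (m + p) f) (2 * (t * Rabs M2 + Rabs M1) * step m).
Proof.
  intros Ht Hf HDf H1 H2. revert m.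
  assert (HB : 0 <= t * Rabs M2 + Rabs M1).
  { pose proof (Rabs_pos M1). pose proof (Rabs_pos M2). nra. }
  induction p as [|p IH]; intros m.
  - rewrite Nat.add_0_r. apply close_refl. pose proof (step_pos m). nra.
  - replace (m + S p)%nat with (S m + p)%nat by lia.
    eapply close_le; [eapply close_trans; [apply euler_succ with (1 := Ht) (M1 := M1) (M2 := M2); auto|apply IH]|].
    rewrite step_S. lra.
Qed.

Lemma finsupp_dom f : finsupp f -> dom f.
Proof. intros H. split; apply finsupp_C0; [|apply finsupp_D]; exact H. Qed.

Lemma euler_cauchy t f eps : 0 <= t -> C0 f -> eps > 0 ->
  exists m0, forall m n, (m >= m0)%nat -> (n >= m0)%nat -> close (euler t m f) (euler t n f) eps.
Proof.
  intros Ht Hf He.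
  destruct (finsupp_dense f (eps / 6) Hf ltac:(lra)) as [g [Hg Hfg]].
  pose proof (finsupp_dom g Hg) as Hd. pose proof (finsupp_dom _ (finsupp_D g Hg)) as HDd.
  destruct (C0_bounded _ (proj2 Hd)) as [M1 [_ H1]].
  destruct (C0_bounded _ (proj2 HDd)) as [M2 [_ H2]].
  set (B := 2 * (t * Rabs M2 + Rabs M1)).
  assert (HB : 0 <= B).
  { unfold B. pose proof (Rabs_pos M1). pose proof (Rabs_pos M2). nra. }
  destruct (step_cv (eps / 6 / (B + 1))) as [m0 Hm0].
  { apply Rdiv_lt_0_compat; lra. }
  exists m0.
  (* All late approximations are compared with one reference function, built from the finitely
     supported [g] at the index [m0]. *)
  assert (Hone : forall m, (m >= m0)%nat -> close (euler t m f) (euler t m0 g) (eps / 2)).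
  { intros m Hm.
    apply close_le with (eps / 6 + B * step m0).
    - eapply close_trans.
      + apply euler_close; [exact Hf|exact (proj1 Hd)|apply close_sym, Hfg].
      + replace m with (m0 + (m - m0))%nat by lia. apply close_sym, euler_tail; auto.
    - specialize (Hm0 m0 ltac:(lia)). unfold Rdist in Hm0. rewrite Rminus_0_r in Hm0.
      apply Rabs_def2 in Hm0. pose proof (step_pos m0).
      assert ((B + 1) * step m0 <= (B + 1) * (eps / 6 / (B + 1)))
        by (apply Rmult_le_compat_l; lra).
      replace ((B + 1) * (eps / 6 / (B + 1))) with (eps / 6) in * by (field; lra). lra. }
  intros m n Hm Hn. apply close_le with (eps / 2 + eps / 2); [|lra].
  eapply close_trans; [apply Hone, Hm|apply close_sym, Hone, Hn].
Qed.

(** * The limit semigroup *)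

Definition semigroup (t : R) f (x : Omega N) : R :=
  epsilon (inhabits 0) (fun l => Un_cv (fun m => euler t m f x) l).

Lemma semigroup_cv t f x : 0 <= t -> C0 f -> Un_cv (fun m => euler t m f x) (semigroup t f x).
Proof.
  intros Ht Hf. unfold semigroup. apply epsilon_spec.
  destruct (R_complete (fun m => euler t m f x)) as [l Hl]; [|exists l; exact Hl].
  intros eps He. destruct (euler_cauchy t f (eps / 2) Ht Hf ltac:(lra)) as [m0 H0].
  exists m0. intros m n Hm Hn. unfold Rdist. specialize (H0 m n Hm Hn x). lra.
Qed.

(** The limit is defined pointwise; the uniform Cauchy property upgrades it to uniform convergence,
    by passing at each point through an index that may depend on the point. *)
Lemma semigroup_euler t f eps : 0 <= t -> C0 f -> eps > 0 ->
  exists m0, forall m, (m >= m0)%nat -> close (euler t m f) (semigroup t f) eps.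
Proof.
  intros Ht Hf He. destruct (euler_cauchy t f (eps / 2) Ht Hf ltac:(lra)) as [m0 H0].
  exists m0. intros m Hm x.
  destruct (semigroup_cv t f x Ht Hf (eps / 2) ltac:(lra)) as [m1 H1].
  specialize (H1 (Nat.max m0 m1) ltac:(lia)). unfold Rdist in H1.
  specialize (H0 m (Nat.max m0 m1) Hm ltac:(lia) x).
  replace (euler t m f x - semigroup t f x) with
    ((euler t m f x - euler t (Nat.max m0 m1) f x) +
     (euler t (Nat.max m0 m1) f x - semigroup t f x)) by ring.
  eapply Rle_trans; [apply Rabs_triang|]. lra.
Qed.

Lemma semigroup_lin t a1 a2 f g x : 0 <= t -> C0 f -> C0 g ->
  semigroup t (fun y => a1 * f y + a2 * g y) x = a1 * semigroup t f x + a2 * semigroup t g x.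
Proof.
  intros Ht Hf Hg.
  apply (UL_sequence (fun m => euler t m (fun y => a1 * f y + a2 * g y) x)).
  - apply semigroup_cv; [exact Ht|apply C0_lin; assumption].
  - apply Un_cv_ext with (fun m => a1 * euler t m f x + a2 * euler t m g x).
    + intros m. unfold euler. rewrite resolvent_iter_lin; auto using step_small.
    + apply CV_plus; apply CV_mult with (An := fun _ => _);
        auto using Un_cv_const, semigroup_cv.
Qed.

Lemma semigroup_nonneg t f x : 0 <= t -> C0 f -> (forall y, 0 <= f y) -> 0 <= semigroup t f x.
Proof.
  intros Ht Hf H.
  apply Rle_cv_lim with (Un := fun _ => 0) (Vn := fun m => euler t m f x);
    auto using Un_cv_const, semigroup_cv.
  intros m. apply resolvent_iter_nonneg; auto using step_small.
Qed.

Lemma semigroup_bound t f M x : 0 <= t -> C0 f -> (forall y, Rabs (f y) <= M) ->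
  Rabs (semigroup t f x) <= M.
Proof.
  intros Ht Hf H.
  apply Rle_cv_lim with (Un := fun m => Rabs (euler t m f x)) (Vn := fun _ => M);
    auto using Un_cv_const.
  - intros m. apply resolvent_iter_bound; auto using step_small.
  - apply cv_cvabs, semigroup_cv; assumption.
Qed.

Lemma semigroup_close t f g e : 0 <= t -> C0 f -> C0 g -> close f g e ->
  close (semigroup t f) (semigroup t g) e.
Proof.
  intros Ht Hf Hg H x.
  replace (semigroup t f x - semigroup t g x)
    with (semigroup t (fun y => 1 * f y + (-1) * g y) x)
    by (rewrite semigroup_lin by assumption; ring).
  apply semigroup_bound; auto using C0_lin.
  intros y. replace (1 * f y + -1 * g y) with (f y - g y) by ring. apply H.
Qed.

Lemma semigroup_C0 t f : 0 <= t -> C0 f -> C0 (semigroup t f).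
Proof.
  intros Ht Hf. apply C0_closed. intros eps He.
  destruct (semigroup_euler t f eps Ht Hf He) as [m0 H0].
  exists (euler t m0 f). split; [apply euler_C0, Hf|]. apply close_sym, H0. lia.
Qed.

Lemma semigroup_0 f x : C0 f -> semigroup 0 f x = f x.
Proof.
  intros Hf. apply (UL_sequence (fun m => euler 0 m f x)).
  - apply semigroup_cv; [lra|exact Hf].
  - apply Un_cv_ext with (fun _ => f x); [|apply Un_cv_const].
    intros m. unfold euler. replace (floor_nat (0 / step m)) with 0%nat; [reflexivity|].
    destruct (floor_nat_spec (0 / step m)) as [H1 _]; unfold Rdiv in *; rewrite Rmult_0_l in *; [lra|].
    symmetry. apply INR_eq. simpl. pose proof (pos_INR (floor_nat 0)). lra.
Qed.

(** Serves the semigroup law, where rounding times down may lose one step. The threshold [m0] is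
    uniform in [n], because the resolvents are contractions and commute with D. *)
Lemma resolvent_small_shift f eps : C0 f -> eps > 0 -> exists m0, forall m, (m >= m0)%nat ->
  forall n, close (Nat.iter (S n) (resolvent (step m)) f) (Nat.iter n (resolvent (step m)) f) eps.
Proof.
  intros Hf He. destruct (finsupp_dense f (eps / 4) Hf ltac:(lra)) as [g [Hg Hfg]].
  pose proof (finsupp_dom g Hg) as Hd.
  destruct (C0_bounded _ (proj2 Hd)) as [M [HM0 HM]].
  destruct (step_cv (eps / 2 / (M + 1))) as [m0 Hm0]; [apply Rdiv_lt_0_compat; lra|].
  exists m0. intros m Hm n. specialize (Hm0 m Hm). unfold Rdist in Hm0.
  rewrite Rminus_0_r in Hm0. apply Rabs_def2 in Hm0. pose proof (step_pos m) as Hs.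
  set (h := step m) in *.
  pose proof (step_small m) as Hh. fold h in Hh.
  apply close_le with (eps / 4 + (h * M + eps / 4)).
  - apply close_trans with (Nat.iter (S n) (resolvent h) g).
    { apply resolvent_iter_close; auto; [apply (proj1 Hd)|apply close_sym, Hfg]. }
    apply close_trans with (Nat.iter n (resolvent h) g).
    + simpl. apply resolvent_near_id; auto; [apply resolvent_iter_dom; assumption|].
      rewrite resolvent_iter_commute by assumption.
      apply resolvent_iter_bound; auto. apply (proj2 Hd).
    + apply resolvent_iter_close; auto. apply (proj1 Hd).
  - assert ((M + 1) * h <= (M + 1) * (eps / 2 / (M + 1))) by (apply Rmult_le_compat_l; lra).
    replace ((M + 1) * (eps / 2 / (M + 1))) with (eps / 2) in * by (field; lra). lra.
Qed.

Lemma semigroup_add s t f x : 0 <= s -> 0 <= t -> C0 f ->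
  semigroup (s + t) f x = semigroup s (semigroup t f) x.
Proof.
  intros Hs Ht Hf. apply cond_eq. intros eps He.
  destruct (semigroup_euler (s + t) f (eps / 5) ltac:(lra) Hf ltac:(lra)) as [m1 H1].
  destruct (semigroup_euler t f (eps / 5) Ht Hf ltac:(lra)) as [m2 H2].
  pose proof (semigroup_C0 t f Ht Hf) as HT.
  destruct (semigroup_euler s _ (eps / 5) Hs HT ltac:(lra)) as [m3 H3].
  destruct (resolvent_small_shift f (eps / 5) Hf ltac:(lra)) as [m4 H4].
  set (m := (m1 + m2 + m3 + m4)%nat).
  specialize (H1 m ltac:(lia)). specialize (H2 m ltac:(lia)).
  specialize (H3 m ltac:(lia)). specialize (H4 m ltac:(lia)).
  assert (H5 : close (euler (s + t) m f) (euler s m (euler t m f)) (eps / 5)).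
  { pose proof (euler_time s m Hs). pose proof (euler_time t m Ht).
    pose proof (euler_time (s + t) m ltac:(lra)). pose proof (step_pos m) as Hp.
    unfold euler. rewrite <- Nat.iter_add.
    set (n1 := floor_nat (s / step m)) in *. set (n2 := floor_nat (t / step m)) in *.
    set (n3 := floor_nat ((s + t) / step m)) in *.
    assert (INR n1 + INR n2 < INR n3 + 1) by (apply Rmult_lt_reg_r with (step m); lra).
    assert (INR n3 < INR n1 + INR n2 + 2) by (apply Rmult_lt_reg_r with (step m); lra).
    assert ((n1 + n2 < n3 + 1)%nat) by (apply INR_lt; rewrite !plus_INR; simpl; lra).
    assert ((n3 < n1 + n2 + 2)%nat) by (apply INR_lt; rewrite !plus_INR; simpl; lra).
    (* The integer part of a sum exceeds the sum of the integer parts by 0 or 1. *)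
    assert (Hn : n3 = (n1 + n2)%nat \/ n3 = S (n1 + n2)) by lia.
    destruct Hn as [-> | ->]; [apply close_refl; lra|apply H4]. }
  assert (Hfin : close (semigroup (s + t) f) (semigroup s (semigroup t f))
                   (eps / 5 + (eps / 5 + (eps / 5 + eps / 5)))).
  { eapply close_trans; [apply close_sym, H1|]. eapply close_trans; [apply H5|].
    eapply close_trans; [|apply H3].
    apply euler_close; auto. apply euler_C0, Hf. }
  specialize (Hfin x). lra.
Qed.

Lemma semigroup_near_id t f M : 0 <= t -> dom f -> (forall x, Rabs (D f x) <= M) ->
  close (semigroup t f) f (t * M).
Proof.
  intros Ht Hf HM x.
  apply Rle_cv_lim with (Un := fun m => Rabs (euler t m f x - f x)) (Vn := fun _ => t * M);
    auto using Un_cv_const.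
  - intros m. unfold euler. pose proof (euler_time t m Ht).
    eapply Rle_trans; [apply resolvent_iter_near_id with (M := M); auto using step_small|].
    apply Rmult_le_compat_r; [|lra]. eapply Rle_trans; [apply Rabs_pos|apply (HM x)].
  - apply cv_cvabs, CV_minus; [apply semigroup_cv; [exact Ht|apply Hf]|apply Un_cv_const].
Qed.

Lemma semigroup_continuous f eps : C0 f -> eps > 0 -> exists delta, delta > 0 /\
  forall t, 0 <= t < delta -> close (semigroup t f) f eps.
Proof.
  intros Hf He. destruct (finsupp_dense f (eps / 4) Hf ltac:(lra)) as [g [Hg Hfg]].
  pose proof (finsupp_dom g Hg) as Hd.
  destruct (C0_bounded _ (proj2 Hd)) as [M [HM0 HM]].
  exists (eps / 2 / (M + 1)). split; [apply Rdiv_lt_0_compat; lra|].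
  intros t [Ht Htd]. apply close_le with (eps / 4 + (t * M + eps / 4)).
  - apply close_trans with (semigroup t g).
    + apply semigroup_close; auto; [apply (proj1 Hd)|apply close_sym, Hfg].
    + apply close_trans with g; [apply semigroup_near_id; auto|exact Hfg].
  - assert ((M + 1) * t <= (M + 1) * (eps / 2 / (M + 1))) by (apply Rmult_le_compat_l; lra).
    replace ((M + 1) * (eps / 2 / (M + 1))) with (eps / 2) in * by (field; lra). lra.
Qed.

(** The increment from J^n f to J^(n+1) f is h J^(n+1) (D f), which should be close to h D f. As D f
    need not lie in the domain, a nearby [g] from the domain takes its place; the exchange costs e
    twice, and J^(n+1) g differs from g by at most (n+1) h M. *)
Lemma resolvent_iter_taylor h n f g e M : small h -> dom f -> dom g -> close g (D f) e ->
  (forall x, Rabs (D g x) <= M) ->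
  forall x, Rabs (Nat.iter n (resolvent h) f x - f x - INR n * h * D f x)
            <= INR n * h * (2 * e + INR n * h * M).
Proof.
  intros Hh Hf Hg Hgf HM x. pose proof Hh as [Hp _].
  assert (HM0 : 0 <= M) by (eapply Rle_trans; [apply Rabs_pos|apply (HM x)]).
  induction n as [|n IH]; [simpl; rewrite !Rmult_0_l, !Rminus_diag, Rabs_R0; lra|].
  set (u := Nat.iter n (resolvent h) f) in *.
  assert (Hu : dom u) by (apply resolvent_iter_dom; assumption).
  assert (E : resolvent h u x = u x + h * Nat.iter (S n) (resolvent h) (D f) x).
  { rewrite <- resolvent_iter_commute by assumption.
    change (Nat.iter (S n) (resolvent h) f) with (resolvent h u).
    rewrite <- (resolvent_eq h u Hh (proj1 Hu) x). ring. }
  change (Nat.iter (S n) (resolvent h) f) with (resolvent h u). rewrite E.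
  assert (Hnear : close (Nat.iter (S n) (resolvent h) (D f)) (D f) (2 * e + INR (S n) * h * M)).
  { apply close_le with (e + (INR (S n) * h * M + e)); [|lra].
    apply close_trans with (Nat.iter (S n) (resolvent h) g).
    - apply resolvent_iter_close; [auto|apply (proj2 Hf)|apply (proj1 Hg)|apply close_sym, Hgf].
    - apply close_trans with g; [apply resolvent_iter_near_id; auto|exact Hgf]. }
  specialize (Hnear x). rewrite S_INR in *.
  set (y := Nat.iter (S n) (resolvent h) (D f) x) in *.
  replace (u x + h * y - f x - (INR n + 1) * h * D f x)
    with ((u x - f x - INR n * h * D f x) + h * (y - D f x)) by ring.
  eapply Rle_trans; [apply Rabs_triang|].
  rewrite (Rabs_mult h), (Rabs_pos_eq h) by lra.
  apply Rmult_le_compat_l with (r := h) in Hnear; [|lra].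
  pose proof (pos_INR n).
  assert (INR n * h * (2 * e + INR n * h * M) <= INR n * h * (2 * e + (INR n + 1) * h * M)).
  { apply Rmult_le_compat_l; [nra|]. assert (0 <= h * M) by nra. nra. }
  lra.
Qed.

Lemma semigroup_taylor t f g e M : 0 <= t -> dom f -> dom g -> close g (D f) e ->
  (forall x, Rabs (D g x) <= M) ->
  forall x, Rabs (semigroup t f x - f x - t * D f x) <= t * (2 * e + t * M).
Proof.
  intros Ht Hf Hg Hgf HM x.
  assert (HM0 : 0 <= M) by (eapply Rle_trans; [apply Rabs_pos|apply (HM x)]).
  assert (He0 : 0 <= e) by (eapply Rle_trans; [apply Rabs_pos|apply (Hgf x)]).
  set (tau := fun m => INR (floor_nat (t / step m)) * step m).
  assert (Htau : Un_cv tau t).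
  { intros eps He. destruct (step_cv eps He) as [m0 H0]. exists m0. intros m Hm.
    specialize (H0 m Hm). unfold Rdist in *. rewrite Rminus_0_r in H0. apply Rabs_def2 in H0.
    pose proof (euler_time t m Ht). unfold tau. apply Rabs_def1; lra. }
  apply Rle_cv_lim with
    (Un := fun m => Rabs (euler t m f x - f x - tau m * D f x))
    (Vn := fun m => t * (2 * e + t * M)).
  - intros m. eapply Rle_trans; [apply resolvent_iter_taylor with (e := e) (M := M) (g := g);
      auto using step_small|].
    pose proof (euler_time t m Ht). fold (tau m) in *.
    assert (0 <= tau m).
    { unfold tau. apply Rmult_le_pos; [apply pos_INR|left; apply step_pos]. }
    apply Rmult_le_compat; try lra; [nra|].
    assert (tau m * M <= t * M) by (apply Rmult_le_compat_r; lra). lra.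
  - apply cv_cvabs. apply CV_minus.
    + apply CV_minus; [apply semigroup_cv; [exact Ht|apply Hf]|apply Un_cv_const].
    + apply CV_mult with (Bn := fun _ => D f x); [exact Htau|apply Un_cv_const].
  - apply Un_cv_const.
Qed.

(** * Identification of the generator *)

Lemma generator_of_dom f : dom f -> generator semigroup f (D f).
Proof.
  intros Hf. split; [apply Hf|]. split; [apply Hf|]. intros eps He.
  (* In the bound t (2 e + t M) the choice e = eps/4 uses one half of eps t, and the restriction on
     t leaves the other half for t M. *)
  destruct (finsupp_dense (D f) (eps / 4) (proj2 Hf) ltac:(lra)) as [g [Hg Hgf]].
  pose proof (finsupp_dom g Hg) as Hd.
  destruct (C0_bounded _ (proj2 Hd)) as [M [HM0 HM]].
  exists (eps / 2 / (M + 1)). split; [apply Rdiv_lt_0_compat; lra|].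
  intros t [Ht Htd] x.
  pose proof (semigroup_taylor t f g _ M ltac:(lra) Hf Hd Hgf HM x) as H.
  replace ((semigroup t f x - f x) / t - D f x)
    with ((semigroup t f x - f x - t * D f x) * / t) by (field; lra).
  rewrite Rabs_mult, (Rabs_pos_eq (/ t)) by (left; apply Rinv_0_lt_compat; lra).
  apply Rmult_le_reg_r with t; [exact Ht|].
  rewrite Rmult_assoc, Rinv_l, Rmult_1_r by lra.
  assert ((M + 1) * t <= (M + 1) * (eps / 2 / (M + 1))) by (apply Rmult_le_compat_l; lra).
  replace ((M + 1) * (eps / 2 / (M + 1))) with (eps / 2) in * by (field; lra).
  eapply Rle_trans; [exact H|]. rewrite (Rmult_comm eps). apply Rmult_le_compat_l; lra.
Qed.

Lemma generator_lin a1 a2 f1 f2 g1 g2 :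
  generator semigroup f1 g1 -> generator semigroup f2 g2 ->
  generator semigroup (fun x => a1 * f1 x + a2 * f2 x) (fun x => a1 * g1 x + a2 * g2 x).
Proof.
  intros [Hf1 [Hg1 H1]] [Hf2 [Hg2 H2]].
  split; [apply C0_lin; assumption|]. split; [apply C0_lin; assumption|].
  intros eps He. pose proof (Rabs_pos a1) as P1. pose proof (Rabs_pos a2) as P2.
  set (A := Rabs a1 + Rabs a2 + 1).
  assert (HA : 0 < eps / A) by (apply Rdiv_lt_0_compat; unfold A; lra).
  destruct (H1 _ HA) as [d1 [D1 K1]]. destruct (H2 _ HA) as [d2 [D2 K2]].
  exists (Rmin d1 d2). split; [apply Rmin_pos; assumption|].
  intros t [Ht Htd] x.
  specialize (K1 t ltac:(split; [exact Ht|eapply Rlt_le_trans; [exact Htd|apply Rmin_l]]) x).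
  specialize (K2 t ltac:(split; [exact Ht|eapply Rlt_le_trans; [exact Htd|apply Rmin_r]]) x).
  rewrite semigroup_lin by (auto; lra).
  replace ((a1 * semigroup t f1 x + a2 * semigroup t f2 x - (a1 * f1 x + a2 * f2 x)) / t
    - (a1 * g1 x + a2 * g2 x)) with
    (a1 * ((semigroup t f1 x - f1 x) / t - g1 x) + a2 * ((semigroup t f2 x - f2 x) / t - g2 x))
    by (field; lra).
  eapply Rle_trans; [apply Rabs_triang|]. rewrite !Rabs_mult.
  apply Rle_trans with ((Rabs a1 + Rabs a2) * (eps / A)).
  - apply Rmult_le_compat_l with (r := Rabs a1) in K1; [|lra].
    apply Rmult_le_compat_l with (r := Rabs a2) in K2; [|lra]. lra.
  - replace eps with (A * (eps / A)) at 2 by (field; unfold A; lra).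
    apply Rmult_le_compat_r; [lra|]. unfold A. lra.
Qed.

(* At a point where [|v|] is maximal, [T t v] cannot grow at a positive rate. *)
Lemma generator_no_eigenvector h v :
  0 < h -> generator semigroup v (fun x => / h * v x) -> forall x, v x = 0.
Proof.
  intros Hh [Hv [_ Hgen]] x.
  destruct (C0_argmax v x Hv) as [x0 H0].
  set (B := Rabs (v x0)).
  assert (HB : B <= 0).
  { apply Rnot_lt_le. intros HB.
    assert (He : B / h / 2 > 0).
    { apply Rdiv_lt_0_compat; [apply Rdiv_lt_0_compat|]; lra. }
    destruct (Hgen _ He) as [d [Hd K]]. specialize (K (d / 2) ltac:(lra) x0).
    set (t := d / 2) in *. assert (Ht : 0 < t) by (unfold t; lra).
    pose proof (semigroup_bound t v B x0 ltac:(lra) Hv H0) as Hb.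
    assert (E : (1 + t / h) * v x0 =
      semigroup t v x0 - t * ((semigroup t v x0 - v x0) / t - / h * v x0)) by (field; lra).
    apply (f_equal Rabs) in E. rewrite Rabs_mult in E. fold B in E.
    assert (Hth : 0 < t / h) by (apply Rdiv_lt_0_compat; lra).
    rewrite (Rabs_pos_eq (1 + t / h)) in E by lra.
    assert (Hle : (1 + t / h) * B <= B + t * (B / h / 2)).
    { rewrite E. eapply Rle_trans; [apply Rabs_triang|]. rewrite Rabs_Ropp, Rabs_mult.
      rewrite (Rabs_pos_eq t) by lra.
      apply Rmult_le_compat_l with (r := t) in K; lra. }
    replace (t * (B / h / 2)) with (t / h * B / 2) in Hle by (field; lra).
    assert (0 < t / h * B) by (apply Rmult_lt_0_compat; assumption). lra. }
  specialize (H0 x). fold B in H0.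
  pose proof (Rabs_le_bounds (v x) 0 ltac:(lra)). lra.
Qed.

(** Let u be the resolvent of f - h g. Subtracting the two equations shows that the generator maps f
    - u to (f - u)/h, which forces f = u; so f lies in the domain. *)
Lemma generator_dom f g : generator semigroup f g -> dom f /\ forall x, g x = D f x.
Proof.
  intros Hgen. pose proof Hgen as [Hf [Hg _]].
  set (h := step 0). pose proof (step_small 0) as Hh. fold h in Hh. pose proof Hh as [Hp _].
  set (k := fun x => 1 * f x + (- h) * g x).
  assert (Hk : C0 k) by (apply C0_lin; assumption).
  set (u := resolvent h k).
  assert (Hu : dom u) by (apply resolvent_dom; assumption).
  assert (Hv : generator semigroup (fun x => 1 * f x + (-1) * u x)
                 (fun x => 1 * g x + (-1) * D u x))
    by (apply generator_lin; [exact Hgen|apply generator_of_dom, Hu]).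
  assert (E : forall x, u x - h * D u x = f x - h * g x).
  { intros x. unfold u. rewrite resolvent_eq by assumption. unfold k. ring. }
  assert (Efu : f = u).
  { extensionality x.
    assert (H0 : 1 * f x + (-1) * u x = 0); [|lra].
    apply (generator_no_eigenvector h (fun x => 1 * f x + (-1) * u x) Hp).
    replace (fun x => / h * (1 * f x + (-1) * u x)) with (fun x => 1 * g x + (-1) * D u x);
      [exact Hv|].
    extensionality y. specialize (E y). apply Rmult_eq_reg_l with h; [|lra].
    rewrite <- Rmult_assoc, Rinv_r by lra. lra. }
  subst u. rewrite <- Efu in *. split; [exact Hu|].
  intros x. specialize (E x). apply Rmult_eq_reg_l with h; lra.
Qed.

(** * Transition kernel and conservation of mass *)

Definition delta (y x : Omega N) : R := if excluded_middle_informative (x = y) then 1 else 0.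

Definition kernel (t : R) (x y : Omega N) : R := semigroup t (delta y) x.

Lemma delta_C0 y : C0 (delta y).
Proof.
  apply (C0_finite_support _ (y :: nil)). intros x Hx. unfold delta.
  destruct excluded_middle_informative as [->|]; [|reflexivity].
  exfalso. apply Hx. left. reflexivity.
Qed.

(** For a list without repetitions this is [f] times the indicator of [L]. Writing it as a
    combination of point masses lets linearity of the semigroup produce finite kernel sums. *)
Definition restrict f (L : list (Omega N)) (x : Omega N) : R :=
  fold_right Rplus 0 (map (fun y => f y * delta y x) L).

Lemma restrict_out f L x : ~ In x L -> restrict f L x = 0.
Proof.
  unfold restrict. induction L as [|y L IH]; simpl; intros H; [reflexivity|].
  unfold delta at 1. destruct excluded_middle_informative as [->|].
  - exfalso. apply H. left. reflexivity.
  - rewrite IH by (intro; apply H; right; assumption). ring.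
Qed.

Lemma restrict_in f L x : NoDup L -> In x L -> restrict f L x = f x.
Proof.
  intros HL. induction HL as [|y L Hy HL IH]; simpl; [intros []|].
  intros H. unfold restrict in *. simpl. unfold delta at 1.
  destruct excluded_middle_informative as [->|Hxy].
  - rewrite (restrict_out f L y Hy : fold_right Rplus 0 _ = 0). ring.
  - destruct H as [->|H]; [contradiction|]. rewrite IH by exact H. ring.
Qed.

Lemma restrict_C0 f L : C0 (restrict f L).
Proof. apply (C0_finite_support _ L), restrict_out. Qed.

Lemma semigroup_restrict t f L x : 0 <= t ->
  fold_right Rplus 0 (map (fun y => kernel t x y * f y) L) = semigroup t (restrict f L) x.
Proof.
  intros Ht. induction L as [|y L IH].
  (* The empty sum needs the semigroup to send 0 to 0. Linearity with zero coefficients gives this,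
     once the zero function is displayed as a combination of [C0] functions. *)
  - simpl. replace (restrict f nil) with (fun x : Omega N => 0 * delta x x + 0 * delta x x).
    2:{ extensionality z. unfold restrict. simpl. ring. }
    assert (H0 : C0 (fun z : Omega N => delta z z - delta z z)).
    { apply (C0_finite_support _ nil). intros. ring. }
    replace (fun z : Omega N => 0 * delta z z + 0 * delta z z)
      with (fun z : Omega N => 0 * (delta z z - delta z z) + 0 * (delta z z - delta z z))
      by (extensionality z; ring).
    rewrite (semigroup_lin t 0 0 _ _ x Ht H0 H0). ring.
  - simpl. rewrite IH. unfold kernel at 1.
    replace (restrict f (y :: L)) with (fun z => f y * delta y z + 1 * restrict f L z).
    + rewrite semigroup_lin by auto using delta_C0, restrict_C0. ring.
    + extensionality z. unfold restrict. simpl. ring.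
Qed.

(** Once [L] contains the set where [f] is not small, [restrict f L] is uniformly close to [f], and
    the semigroup is a contraction. *)
Lemma kernel_integral t f x : 0 <= t -> C0 f ->
  has_sum (fun y => kernel t x y * f y) (semigroup t f x).
Proof.
  intros Ht Hf eps He. destruct (Hf (eps / 2) ltac:(lra)) as [K HK].
  exists K. intros L HL HKL. rewrite semigroup_restrict by exact Ht.
  apply Rle_lt_trans with (eps / 2); [|lra].
  apply semigroup_close; auto using restrict_C0. intros y.
  destruct (classic (In y L)) as [Hy|Hy].
  - rewrite restrict_in, Rminus_diag, Rabs_R0 by assumption. lra.
  - rewrite restrict_out by exact Hy. rewrite Rminus_0_l, Rabs_Ropp. left. apply HK.
    intros HyK. apply Hy, HKL, HyK.
Qed.

Lemma euler_ge t m g r : 0 <= t -> C0 g -> 0 < r -> (forall x, 1 - r * psi x <= g x) ->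
  forall x, 1 - r * exp (2 * c * t) * psi x <= euler t m g x.
Proof.
  intros Ht Hg Hr H x.
  pose proof (step_small m) as Hh. pose proof (euler_time t m Ht) as [Hn _].
  eapply Rle_trans; [|apply resolvent_iter_ge with (r := r); auto].
  set (h := step m) in *. set (n := floor_nat (t / h)) in *.
  assert (Hpow : (/ (1 - h * c)) ^ n <= exp (2 * c * t)).
  { destruct Hh as [Hp Hhc].
    (* For 0 <= q <= 1/2 one has 1/(1 - q) <= 1 + 2q <= exp(2q); this is the origin of the factor 2
       in the exponent. *)
    assert (Hone : / (1 - h * c) <= exp (2 * h * c)).
    { assert (1 + 2 * h * c <= exp (2 * h * c)) by apply exp_ineq1_le.
      apply Rle_trans with (1 + 2 * h * c); [|lra].
      assert (0 <= h * c) by (apply Rmult_le_pos; lra).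
      apply Rmult_le_reg_l with (1 - h * c); [lra|]. rewrite Rinv_r by lra.
      set (q := h * c) in *. replace (2 * h * c) with (2 * q) by (unfold q; ring). nra. }
    apply Rle_trans with (exp (2 * h * c) ^ n).
    - apply pow_incr. split; [|exact Hone]. left. apply Rinv_0_lt_compat. lra.
    - rewrite <- Rpower_pow by apply exp_pos. unfold Rpower. rewrite ln_exp.
      assert (INR n * (2 * h * c) <= 2 * c * t).
      { replace (INR n * (2 * h * c)) with (2 * c * (INR n * h)) by ring.
        apply Rmult_le_compat_l; lra. }
      destruct (Rle_lt_or_eq_dec _ _ H0) as [Hlt|Heq].
      + left. apply exp_increasing, Hlt.
      + rewrite Heq. lra. }
  assert (r * (/ (1 - h * c)) ^ n * psi x <= r * exp (2 * c * t) * psi x); [|lra].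
  apply Rmult_le_compat_r; [pose proof (psi_ge1 x); lra|].
  apply Rmult_le_compat_l; lra.
Qed.

(** The constant 1 need not be in [C0], so the mass is tested on indicators of finite sets [L]. If
    [L] contains the set psi <= 1/r, its indicator dominates 1 - r psi, and this lower bound
    survives the evolution with r enlarged by exp(2 c t). *)
Lemma kernel_mass t x : 0 <= t -> has_sum (kernel t x) 1.
Proof.
  intros Ht eps He.
  (* Chosen so that the loss of mass at time t, seen from x, is at most eps/2. *)
  set (r := eps / 2 / (exp (2 * c * t) * psi x)).
  assert (Hep : 0 < exp (2 * c * t) * psi x).
  { apply Rmult_lt_0_compat; [apply exp_pos|pose proof (psi_ge1 x); lra]. }
  assert (Hr : 0 < r) by (apply Rdiv_lt_0_compat; lra).
  destruct (psi_proper (/ r)) as [K HK].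
  exists K. intros L HL HKL.
  replace (map (kernel t x) L) with (map (fun y => kernel t x y * 1) L)
    by (apply map_ext; intros; ring).
  rewrite semigroup_restrict by exact Ht.
  set (g := restrict (fun _ => 1) L).
  assert (Hg : C0 g) by apply restrict_C0.
  assert (Hg01 : forall y, 0 <= g y <= 1).
  { intros y. destruct (classic (In y L)) as [Hy|Hy]; unfold g.
    - rewrite restrict_in by assumption. lra.
    - rewrite restrict_out by assumption. lra. }
  assert (Hup : semigroup t g x <= 1).
  { apply (Rabs_le_bounds _ 1), semigroup_bound; auto. intros y.
    specialize (Hg01 y). apply Rabs_le. lra. }
  assert (Hlow : 1 - r * exp (2 * c * t) * psi x <= semigroup t g x).
  { apply Rle_cv_lim with (Un := fun _ => 1 - r * exp (2 * c * t) * psi x)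
      (Vn := fun m => euler t m g x); auto using Un_cv_const, semigroup_cv.
    intros m. apply euler_ge; auto. intros y.
    destruct (Rle_dec (psi y) (/ r)) as [Hy|Hy].
    - assert (In y L) by auto. unfold g. rewrite restrict_in by assumption.
      pose proof (psi_ge1 y). assert (0 <= r * psi y) by (apply Rmult_le_pos; lra). lra.
    - apply Rle_trans with 0; [|apply Hg01].
      assert (r * / r <= r * psi y) by (apply Rmult_le_compat_l; lra).
      rewrite Rinv_r in * by lra. lra. }
  replace (r * exp (2 * c * t) * psi x) with (eps / 2) in Hlow.
  - apply Rabs_def1; lra.
  - unfold r. field. split; [pose proof (psi_ge1 x); lra|]. pose proof (exp_pos (2 * c * t)). lra.
Qed.

Theorem lyapunov_feller :
  feller_semigroup kernel semigroup /\
  forall f g, generator semigroup f g <-> C0 f /\ C0 (D f) /\ forall x, g x = D f x.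
Proof.
  split.
  - unfold feller_semigroup. repeat split.
    + intros t x y Ht. apply semigroup_nonneg; auto using delta_C0. intros z.
      unfold delta. destruct excluded_middle_informative; lra.
    + intros t x Ht. apply kernel_mass, Ht.
    + intros t f x Ht Hf. apply kernel_integral; assumption.
    + intros t f Ht Hf. apply semigroup_C0; assumption.
    + intros f x Hf. apply semigroup_0, Hf.
    + intros s t f x Hs Ht Hf. apply semigroup_add; assumption.
    + intros f Hf eps He. destruct (semigroup_continuous f eps Hf He) as [d [Hd K]].
      exists d. split; [exact Hd|]. intros t Ht x. apply K, Ht.
  - intros f g. split.
    + intros H. destruct (generator_dom f g H) as [[H1 H2] H3]. auto.
    + intros [H1 [H2 H3]]. replace g with (D f) by (extensionality x; auto).
      apply generator_of_dom. split; assumption.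
Qed.

End Resolvent.

(** * Moments of Vandermonde ratios *)

Lemma fold_Rplus_app (l1 l2 : list R) :
  fold_right Rplus 0 (l1 ++ l2) = fold_right Rplus 0 l1 + fold_right Rplus 0 l2.
Proof. induction l1 as [|r l IH]; simpl; [ring|rewrite IH; ring]. Qed.

Lemma fsum_S n F : fsum (S n) F = fsum n F + F n.
Proof.
  unfold fsum. rewrite seq_S, map_app, fold_Rplus_app. simpl. ring.
Qed.

Lemma fprod_S n F : fprod (S n) F = fprod n F * F n.
Proof.
  unfold fprod. rewrite seq_S, map_app. simpl.
  induction (map F (seq 0 n)) as [|r l IH]; simpl; [ring|rewrite IH; ring].
Qed.

Lemma fsum_ext n F G : (forall k, (k < n)%nat -> F k = G k) -> fsum n F = fsum n G.
Proof.
  induction n as [|n IH]; intros H; [reflexivity|].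
  rewrite !fsum_S, IH, H; auto.
Qed.

Lemma fprod_ext n F G : (forall k, (k < n)%nat -> F k = G k) -> fprod n F = fprod n G.
Proof.
  induction n as [|n IH]; intros H; [reflexivity|].
  rewrite !fprod_S, IH, H; auto.
Qed.

Lemma fsum_lin n a b F G :
  fsum n (fun k => a * F k + b * G k) = a * fsum n F + b * fsum n G.
Proof. induction n as [|n IH]; [unfold fsum; simpl; ring|]. rewrite !fsum_S, IH. ring. Qed.

Lemma fprod_mult n F G : fprod n (fun k => F k * G k) = fprod n F * fprod n G.
Proof. induction n as [|n IH]; [unfold fprod; simpl; ring|]. rewrite !fprod_S, IH. ring. Qed.

Lemma fsum_le n F G : (forall k, (k < n)%nat -> F k <= G k) -> fsum n F <= fsum n G.
Proof.
  induction n as [|n IH]; intros H; [unfold fsum; simpl; lra|].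
  rewrite !fsum_S. apply Rplus_le_compat; auto.
Qed.

Lemma fsum_const n a : fsum n (fun _ => a) = INR n * a.
Proof. induction n as [|n IH]; [unfold fsum; simpl; ring|]. rewrite fsum_S, S_INR, IH. ring. Qed.

Lemma fprod_bounds n b F : 1 <= b -> (forall k, (k < n)%nat -> 0 <= F k <= b) ->
  0 <= fprod n F <= b ^ n.
Proof.
  intros Hb. induction n as [|n IH]; intros H; [unfold fprod; simpl; lra|].
  rewrite fprod_S. destruct IH as [I1 I2]; auto. destruct (H n) as [H1 H2]; auto.
  simpl. rewrite (Rmult_comm b). split; [apply Rmult_le_pos|apply Rmult_le_compat]; assumption.
Qed.

Lemma fprod_zero n F k : (k < n)%nat -> F k = 0 -> fprod n F = 0.
Proof.
  induction n as [|n IH]; intros Hk HF; [lia|]. rewrite fprod_S.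
  destruct (Nat.eq_dec k n) as [->|]; [rewrite HF; ring|rewrite IH by (auto; lia); ring].
Qed.

Lemma fprod_neq_0 n F : (forall k, (k < n)%nat -> F k <> 0) -> fprod n F <> 0.
Proof.
  induction n as [|n IH]; intros H; [unfold fprod; simpl; lra|].
  rewrite fprod_S. apply Rmult_integral_contrapositive_currified; auto.
Qed.

Lemma fprod_one n F : (forall k, (k < n)%nat -> F k = 1) -> fprod n F = 1.
Proof.
  induction n as [|n IH]; intros H; [reflexivity|]. rewrite fprod_S, IH, H by auto. ring.
Qed.

Lemma fprod_single n k a : (k < n)%nat -> fprod n (fun i => if (i =? k)%nat then a else 1) = a.
Proof.
  induction n as [|n IH]; intros Hk; [lia|]. rewrite fprod_S.
  destruct (Nat.eqb_spec n k) as [->|].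
  - rewrite fprod_one; [ring|]. intros i Hi. destruct (Nat.eqb_spec i k); [lia|reflexivity].
  - rewrite IH by lia. ring.
Qed.

Lemma fsum_update n k F a : (k < n)%nat ->
  fsum n (fun i => if (i =? k)%nat then a else F i) = fsum n F + (a - F k).
Proof.
  induction n as [|n IH]; intros Hk; [lia|]. rewrite !fsum_S.
  destruct (Nat.eqb_spec n k) as [->|].
  - rewrite (fsum_ext k _ F); [ring|]. intros i Hi.
    destruct (Nat.eqb_spec i k); [lia|reflexivity].
  - rewrite IH by lia. ring.
Qed.

Lemma fsum_term_le n k F : (k < n)%nat -> (forall i, 0 <= F i) -> F k <= fsum n F.
Proof.
  intros Hk H. pose proof (fsum_update n k F 0 Hk) as E.
  assert (0 <= fsum n (fun i => if (i =? k)%nat then 0 else F i)); [|lra].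
  replace 0 with (fsum n (fun _ => 0)) at 1 by (rewrite fsum_const; ring).
  apply fsum_le. intros i _. destruct (i =? k)%nat; [lra|apply H].
Qed.

(* [V(n + u e_k) / V(n)] at [n_i = x i]. *)
Definition vand_ratio (n : nat) (x : nat -> R) (u : R) (k : nat) : R :=
  fprod n (fun j => if (j =? k)%nat then 1 else 1 + u / (x k - x j)).

Definition separated (n : nat) (x : nat -> R) : Prop :=
  forall i j, (i < n)%nat -> (j < n)%nat -> i <> j -> 1 <= Rabs (x i - x j).

Lemma separated_neq n x i j : separated n x -> (i < n)%nat -> (j < n)%nat -> i <> j ->
  x i - x j <> 0.
Proof.
  intros H Hi Hj Hij E. specialize (H i j Hi Hj Hij). rewrite E, Rabs_R0 in H. lra.
Qed.

Lemma vand_ratio_S n x u k : (k < n)%nat ->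
  vand_ratio (S n) x u k = vand_ratio n x u k * (1 + u / (x k - x n)).
Proof.
  intros Hk. unfold vand_ratio. rewrite fprod_S.
  destruct (Nat.eqb_spec n k); [lia|reflexivity].
Qed.

Lemma vand_ratio_last n x u :
  vand_ratio (S n) x u n = fprod n (fun j => 1 + u / (x n - x j)).
Proof.
  unfold vand_ratio. rewrite fprod_S, Nat.eqb_refl, Rmult_1_r.
  apply fprod_ext. intros j Hj. destruct (Nat.eqb_spec j n); [lia|reflexivity].
Qed.

(** Partial fraction expansion, in m, of the product of the factors 1 + u/(m - x_j) minus 1: it
    vanishes at infinity and has simple poles at x_k with residue u times the Vandermonde ratio. *)
Lemma partial_fractions n x u m :
  (forall i j, (i < n)%nat -> (j < n)%nat -> i <> j -> x i - x j <> 0) ->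
  (forall j, (j < n)%nat -> m - x j <> 0) ->
  fsum n (fun k => u / (m - x k) * vand_ratio n x u k) =
  fprod n (fun j => 1 + u / (m - x j)) - 1.
Proof.
  revert m. induction n as [|n IH]; intros m Hx Hm; [unfold fsum, fprod; simpl; ring|].
  rewrite fsum_S, fprod_S, vand_ratio_last.
  pose proof (IH m ltac:(auto) ltac:(auto)) as I1.
  pose proof (IH (x n) ltac:(auto) ltac:(intros; apply Hx; lia)) as I2.
  set (v := u / (m - x n)).
  (* The new factor 1 + u/(x_k - x_n) is split so that the induction hypothesis applies once at m
     and once at x_n. *)
  rewrite (fsum_ext n _ (fun k => (1 + v) * (u / (m - x k) * vand_ratio n x u k)
      + (- v) * (u / (x n - x k) * vand_ratio n x u k))).
  - rewrite fsum_lin, I1, I2. ring.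
  - intros k Hk. rewrite vand_ratio_S by exact Hk. unfold v.
    pose proof (Hm k ltac:(lia)). pose proof (Hm n ltac:(lia)).
    pose proof (Hx k n ltac:(lia) ltac:(lia) ltac:(lia)).
    pose proof (Hx n k ltac:(lia) ltac:(lia) ltac:(lia)).
    field. auto.
Qed.

Definition moment (n : nat) (x : nat -> R) (u : R) (p : R -> R) : R :=
  fsum n (fun k => p (x k) * vand_ratio n x u k).

(** Here [p'] is the divided difference of [p] at x_n, not a derivative. It absorbs the denominator
    x_k - x_n of the new factor, while partial fractions at x_n expand the weight of the new
    point. *)
Lemma moment_S n x u p p' : separated (S n) x ->
  (forall s, p s - p (x n) = (s - x n) * p' s) ->
  moment (S n) x u p = moment n x u p + u * moment n x u p' + p (x n).
Proof.
  intros Hx Hp. unfold moment. rewrite fsum_S, vand_ratio_last.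
  assert (Hne : forall i j, (i < S n)%nat -> (j < S n)%nat -> i <> j -> x i - x j <> 0)
    by (intros; eapply separated_neq; eauto).
  pose proof (partial_fractions n x u (x n) ltac:(auto) ltac:(intros; apply Hne; lia)) as E.
  rewrite (fsum_ext n _ (fun k => 1 * (1 * (p (x k) * vand_ratio n x u k)
      + u * (p' (x k) * vand_ratio n x u k))
      + (- p (x n)) * (u / (x n - x k) * vand_ratio n x u k))).
  - rewrite !fsum_lin, E. ring.
  - intros k Hk. rewrite vand_ratio_S by exact Hk.
    pose proof (Hne k n ltac:(lia) ltac:(lia) ltac:(lia)).
    pose proof (Hne n k ltac:(lia) ltac:(lia) ltac:(lia)).
    replace (p (x k)) with (p (x n) + (x k - x n) * p' (x k)) by (rewrite <- Hp; ring).
    field. auto.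
Qed.

Lemma separated_pred n x : separated (S n) x -> separated n x.
Proof. intros H i j Hi Hj. apply H; lia. Qed.

Lemma moment_lin n x u a b p q :
  moment n x u (fun s => a * p s + b * q s) = a * moment n x u p + b * moment n x u q.
Proof. unfold moment. rewrite <- fsum_lin. apply fsum_ext. intros. ring. Qed.

Lemma moment_0 n x u : separated n x -> moment n x u (fun _ => 1) = INR n.
Proof.
  induction n as [|n IH]; intros Hx; [reflexivity|].
  rewrite (moment_S n x u _ (fun _ => 0)) by (auto; intros; ring).
  rewrite IH by (apply separated_pred, Hx). rewrite S_INR.
  replace (moment n x u (fun _ => 0)) with (0 * moment n x u (fun _ => 0) + 0 * moment n x u (fun _ => 0)).
  - ring.
  - rewrite <- moment_lin. unfold moment. apply fsum_ext. intros. ring.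
Qed.

Lemma moment_1_S n x u : separated (S n) x ->
  moment (S n) x u (fun s => s) = moment n x u (fun s => s) + u * INR n + x n.
Proof.
  intros Hx. rewrite (moment_S n x u _ (fun _ => 1)) by (auto; intros; ring).
  rewrite moment_0 by (apply separated_pred, Hx). reflexivity.
Qed.

Lemma moment_2_S n x u : separated (S n) x ->
  moment (S n) x u (fun s => s ^ 2) =
  moment n x u (fun s => s ^ 2) + u * (moment n x u (fun s => s) + x n * INR n) + x n ^ 2.
Proof.
  intros Hx. rewrite (moment_S n x u _ (fun s => 1 * s + x n * 1)) by (auto; intros; ring).
  rewrite moment_lin, moment_0 by (apply separated_pred, Hx). ring.
Qed.

Lemma moment_3_S n x u : separated (S n) x ->
  moment (S n) x u (fun s => s ^ 3) =
  moment n x u (fun s => s ^ 3)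
  + u * (moment n x u (fun s => s ^ 2) + x n * moment n x u (fun s => s) + x n ^ 2 * INR n)
  + x n ^ 3.
Proof.
  intros Hx.
  rewrite (moment_S n x u _ (fun s => 1 * (1 * s ^ 2 + x n * s) + x n ^ 2 * 1))
    by (auto; intros; ring).
  rewrite !moment_lin, moment_0 by (apply separated_pred, Hx). ring.
Qed.

(** * Quadratic bounds for moments and drift *)

Definition energy (n : nat) (x : nat -> R) : R := 1 + fsum n (fun k => x k ^ 2).

Lemma energy_S n x : energy (S n) x = energy n x + x n ^ 2.
Proof. unfold energy. rewrite fsum_S. ring. Qed.

Lemma energy_term n x k : (k < n)%nat -> 1 + x k ^ 2 <= energy n x.
Proof.
  intros Hk. unfold energy. apply Rplus_le_compat_l.
  apply (fsum_term_le n k (fun i => x i ^ 2) Hk). intros i. apply pow2_ge_0.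
Qed.

Lemma energy_ge1 n x : 1 <= energy n x.
Proof.
  induction n as [|n IH]; [unfold energy, fsum; simpl; lra|].
  rewrite energy_S. pose proof (pow2_ge_0 (x n)). lra.
Qed.

(* The leading terms of the third moments at [u = 1] and [u = -1] cancel: the
   difference has degree 2 in the coordinates. *)
Lemma moment_bounds n : exists C, 0 <= C /\ forall x, separated n x ->
  (forall u, Rabs u = 1 -> moment n x u (fun s => s) ^ 2 <= C * energy n x /\
    Rabs (moment n x u (fun s => s ^ 2)) <= C * energy n x) /\
  Rabs (moment n x 1 (fun s => s ^ 3) - moment n x (-1) (fun s => s ^ 3)) <= C * energy n x.
Proof.
  induction n as [|n [C [HC IH]]].
  - exists 0. split; [lra|]. intros x _. unfold moment, fsum. simpl.
    rewrite Rminus_diag, Rabs_R0. repeat split; lra.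
  - set (K := INR n). assert (HK : 0 <= K) by apply pos_INR.
    exists (10 * C + 10 * K ^ 2 + 10). split; [nra|]. intros x Hx.
    destruct (IH x (separated_pred n x Hx)) as [H12 H3].
    pose proof (energy_ge1 n x) as HE. rewrite energy_S. set (E := energy n x) in *.
    set (m := x n) in *. pose proof (pow2_ge_0 m) as Hm.
    assert (HCE : 0 <= C * E) by nra.
    assert (HKE : K ^ 2 <= K ^ 2 * (E + m ^ 2)) by nra.
    assert (HCm : 0 <= C * m ^ 2) by nra.
    assert (Hgoal : forall r, r <= 10 * (C * E) + 10 * K ^ 2 + 10 * K ^ 2 * m ^ 2 + 10 * (1 + m ^ 2) ->
      r <= (10 * C + 10 * K ^ 2 + 10) * (E + m ^ 2)).
    { intros r Hr. assert (K ^ 2 + K ^ 2 * m ^ 2 <= K ^ 2 * (E + m ^ 2)) by nra. lra. }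
    split.
    + intros u Hu. destruct (H12 u Hu) as [H1 H2]. rewrite moment_1_S, moment_2_S by exact Hx.
      fold m K. set (w1 := moment n x u (fun s => s)) in *.
      set (w2 := moment n x u (fun s => s ^ 2)) in *.
      assert (Hu2 : u ^ 2 = 1) by (rewrite <- pow2_abs, Hu; ring).
      split; apply Hgoal.
      * assert ((w1 + u * K + m) ^ 2 <= 3 * (w1 ^ 2 + u ^ 2 * K ^ 2 + m ^ 2)).
        { pose proof (pow2_ge_0 (w1 - u * K)). pose proof (pow2_ge_0 (w1 - m)).
          pose proof (pow2_ge_0 (u * K - m)). nra. }
        rewrite Hu2 in *. nra.
      * eapply Rle_trans; [apply Rabs_triang|]. rewrite (Rabs_pos_eq (m ^ 2)) by exact Hm.
        assert (Rabs (w2 + u * (w1 + m * K)) <= Rabs w2 + Rabs (w1 + m * K)).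
        { eapply Rle_trans; [apply Rabs_triang|]. rewrite Rabs_mult, Hu. lra. }
        assert (Rabs (w1 + m * K) <= 1 + w1 ^ 2 + m ^ 2 + K ^ 2).
        { pose proof (pow2_ge_0 (m - K)). pose proof (pow2_ge_0 (m + K)).
          apply Rabs_le. nra. }
        assert (0 <= K ^ 2 * m ^ 2) by (apply Rmult_le_pos; apply pow2_ge_0).
        pose proof (pow2_ge_0 K). lra.
    + destruct (H12 1 Rabs_R1) as [P1 P2].
      destruct (H12 (-1) ltac:(rewrite Rabs_left; lra)) as [M1 M2].
      rewrite !moment_3_S by exact Hx. fold m K.
      set (p1 := moment n x 1 (fun s => s)) in *. set (p2 := moment n x 1 (fun s => s ^ 2)) in *.
      set (q1 := moment n x (-1) (fun s => s)) in *.
      set (q2 := moment n x (-1) (fun s => s ^ 2)) in *.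
      set (p3 := moment n x 1 (fun s => s ^ 3)) in *.
      set (q3 := moment n x (-1) (fun s => s ^ 3)) in *.
      apply Hgoal.
      apply Rabs_le_bounds in P2, M2, H3.
      (* These squares absorb the products of x_n with first moments; for this reason the first
         moment is controlled through its square. *)
      assert (0 <= (m - p1) ^ 2) by apply pow2_ge_0.
      assert (0 <= (m + p1) ^ 2) by apply pow2_ge_0.
      assert (0 <= (m - q1) ^ 2) by apply pow2_ge_0.
      assert (0 <= (m + q1) ^ 2) by apply pow2_ge_0.
      assert (0 <= m ^ 2 * K) by (apply Rmult_le_pos; assumption).
      assert (m ^ 2 * K <= m ^ 2 * (K ^ 2 + 1)) by (apply Rmult_le_compat_l; nra).
      assert (0 <= K ^ 2) by apply pow2_ge_0.
      assert (0 <= K ^ 2 * m ^ 2) by (apply Rmult_le_pos; assumption).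
      apply Rabs_le. lra.
Qed.

(** Spacing at least 1 places every factor 1 + u/(x_k - x_j) in the interval [0, 2]. *)
Lemma vand_ratio_bounds n x u k : separated n x -> (k < n)%nat -> u = 1 \/ u = -1 ->
  0 <= vand_ratio n x u k <= 2 ^ n.
Proof.
  intros Hx Hk Hu. apply fprod_bounds; [lra|]. intros j Hj.
  destruct (Nat.eqb_spec j k) as [|Hjk]; [lra|].
  specialize (Hx k j Hk Hj ltac:(lia)).
  assert (Rabs (u / (x k - x j)) <= 1).
  { unfold Rdiv. rewrite Rabs_mult, Rabs_inv.
    replace (Rabs u) with 1 by (destruct Hu; subst u; [rewrite Rabs_R1|rewrite Rabs_left]; lra).
    rewrite Rmult_1_l, <- Rinv_1. apply Rinv_le_contravar; lra. }
  apply Rabs_le_bounds in H. lra.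
Qed.

Lemma quadratic_bound p q s : Rabs (s ^ 2 + p * s + q) <= (1 + Rabs p + Rabs q) * (1 + s ^ 2).
Proof.
  pose proof (pow2_ge_0 s) as Hs.
  assert (Hp : Rabs (p * s) <= Rabs p * (1 + s ^ 2)).
  { rewrite Rabs_mult. apply Rmult_le_compat_l; [apply Rabs_pos|].
    rewrite <- pow2_abs. pose proof (pow2_ge_0 (Rabs s - 1)). pose proof (Rabs_pos s). nra. }
  assert (Hq : 0 <= Rabs q * s ^ 2) by (apply Rmult_le_pos; [apply Rabs_pos|exact Hs]).
  eapply Rle_trans; [apply Rabs_triang|].
  eapply Rle_trans; [apply Rplus_le_compat_r, Rabs_triang|].
  rewrite (Rabs_pos_eq (s ^ 2)) by exact Hs. lra.
Qed.

Lemma fsum_abs_le n F b : (forall k, (k < n)%nat -> Rabs (F k) <= b) ->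
  Rabs (fsum n F) <= INR n * b.
Proof.
  intros H. rewrite <- fsum_const. apply Rabs_le. split.
  - replace (- fsum n (fun _ => b)) with (fsum n (fun _ => - b)) by (rewrite !fsum_const; ring).
    apply fsum_le. intros k Hk. specialize (H k Hk). apply Rabs_le_bounds in H. lra.
  - apply fsum_le. intros k Hk. specialize (H k Hk). apply Rabs_le_bounds in H. lra.
Qed.

(** Both quadratics are monic, so the cubic part of the sum is twice the difference of the third
    moments at u = 1 and u = -1, bounded by [moment_bounds]. What remains is quadratic in x_k and is
    estimated term by term, with weights at most 2^n. *)
Lemma drift_bound n p1 q1 p2 q2 : exists C, 0 <= C /\ forall x, separated n x ->
  Rabs (fsum n (fun k =>
    vand_ratio n x 1 k * (x k ^ 2 + p1 * x k + q1) * (2 * x k + 1)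
    + vand_ratio n x (-1) k * (x k ^ 2 + p2 * x k + q2) * (-2 * x k + 1)))
  <= C * energy n x.
Proof.
  destruct (moment_bounds n) as [C [HC Hmom]].
  set (B := fun p q => 1 + 4 * Rabs p + 4 * Rabs q).
  assert (HB : forall p q, 0 <= B p q).
  { intros p q. unfold B. pose proof (Rabs_pos p). pose proof (Rabs_pos q). lra. }
  (* Here [e] is the direction of the jump; removing 2 e s^3 leaves degree 2. *)
  assert (Hlow : forall e p q s, e = 1 \/ e = -1 ->
    Rabs ((s ^ 2 + p * s + q) * (2 * e * s + 1) - 2 * e * s ^ 3) <= B p q * (1 + s ^ 2)).
  { intros e p q s He. pose proof (pow2_ge_0 s) as Hs.
    assert (Hs1 : Rabs s <= 1 + s ^ 2).
    { apply Rabs_le. pose proof (pow2_ge_0 (s - 1)). pose proof (pow2_ge_0 (s + 1)). nra. }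
    assert (E1 : Rabs (e * (p * s ^ 2)) <= Rabs p * (1 + s ^ 2)).
    { rewrite !Rabs_mult. rewrite (Rabs_pos_eq (s ^ 2)) by exact Hs.
      replace (Rabs e) with 1 by (destruct He; subst e; [rewrite Rabs_R1|rewrite Rabs_left]; lra).
      pose proof (Rabs_pos p). nra. }
    assert (E2 : Rabs (e * (q * s)) <= Rabs q * (1 + s ^ 2)).
    { rewrite !Rabs_mult.
      replace (Rabs e) with 1 by (destruct He; subst e; [rewrite Rabs_R1|rewrite Rabs_left]; lra).
      pose proof (Rabs_pos q). nra. }
    assert (E3 : Rabs (p * s) <= Rabs p * (1 + s ^ 2)).
    { rewrite Rabs_mult. apply Rmult_le_compat_l; [apply Rabs_pos|exact Hs1]. }
    assert (E4 : Rabs q <= Rabs q * (1 + s ^ 2)) by (pose proof (Rabs_pos q); nra).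
    assert (0 <= Rabs p * (1 + s ^ 2)) by (apply Rmult_le_pos; [apply Rabs_pos|lra]).
    assert (0 <= Rabs q * (1 + s ^ 2)) by (apply Rmult_le_pos; [apply Rabs_pos|lra]).
    apply Rabs_le_bounds in E1, E2, E3, E4. unfold B. apply Rabs_le. split; nra. }
  exists (2 * C + INR n * (2 ^ n * (B p1 q1 + B p2 q2))). split.
  { apply Rplus_le_le_0_compat; [lra|]. apply Rmult_le_pos; [apply pos_INR|].
    apply Rmult_le_pos; [left; apply pow_lt; lra|]. apply Rplus_le_le_0_compat; apply HB. }
  intros x Hx. destruct (Hmom x Hx) as [_ H3].
  set (rest := fun k =>
    vand_ratio n x 1 k * ((x k ^ 2 + p1 * x k + q1) * (2 * 1 * x k + 1) - 2 * 1 * x k ^ 3)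
    + vand_ratio n x (-1) k
      * ((x k ^ 2 + p2 * x k + q2) * (2 * -1 * x k + 1) - 2 * -1 * x k ^ 3)).
  rewrite (fsum_ext n _ (fun k => 2 * (1 * (x k ^ 3 * vand_ratio n x 1 k)
      + (-1) * (x k ^ 3 * vand_ratio n x (-1) k)) + 1 * rest k))
    by (intros k _; unfold rest; ring).
  rewrite !fsum_lin.
  change (fsum n (fun k => x k ^ 3 * vand_ratio n x 1 k)) with (moment n x 1 (fun s => s ^ 3)).
  change (fsum n (fun k => x k ^ 3 * vand_ratio n x (-1) k))
    with (moment n x (-1) (fun s => s ^ 3)).
  assert (Hrest : Rabs (fsum n rest)
                  <= INR n * (2 ^ n * (B p1 q1 + B p2 q2) * energy n x)).
  { apply fsum_abs_le. intros k Hk. unfold rest.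
    assert (Hterm : forall e p q, e = 1 \/ e = -1 -> Rabs (vand_ratio n x e k *
      ((x k ^ 2 + p * x k + q) * (2 * e * x k + 1) - 2 * e * x k ^ 3))
      <= 2 ^ n * (B p q * energy n x)).
    { intros e p q He. rewrite Rabs_mult.
      pose proof (vand_ratio_bounds n x e k Hx Hk He) as Hr.
      rewrite (Rabs_pos_eq (vand_ratio n x e k)) by lra.
      apply Rmult_le_compat; [lra|apply Rabs_pos|lra|].
      eapply Rle_trans; [apply Hlow, He|].
      apply Rmult_le_compat_l; [apply HB|apply energy_term, Hk]. }
    eapply Rle_trans; [apply Rabs_triang|].
    pose proof (Hterm 1 p1 q1 ltac:(auto)). pose proof (Hterm (-1) p2 q2 ltac:(auto)). lra. }
  apply Rabs_le_bounds in H3, Hrest. apply Rabs_le. lra.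
Qed.

(** * The operator D as a jump operator *)

Lemma is_omega_irrel N (x y : Omega N) : proj1_sig x = proj1_sig y -> x = y.
Proof.
  destruct x as [l Hl], y as [l' Hl']. simpl. intros <-. f_equal.
  apply Eqdep_dec.UIP_dec, Bool.bool_dec.
Qed.

Lemma strict_decr_iff l : strict_decr l = true <->
  forall i j, (i < j < length l)%nat -> (nth j l 0 < nth i l 0)%Z.
Proof.
  induction l as [|a [|b l] IH].
  - simpl. split; [intros _ i j H; lia|reflexivity].
  - simpl. split; [intros _ i j H; lia|reflexivity].
  - change (strict_decr (a :: b :: l)) with (Z.gtb a b && strict_decr (b :: l))%bool.
    rewrite Bool.andb_true_iff, IH, Z.gtb_lt. split.
    + intros [Hab H] i j Hij. destruct j as [|j]; [lia|]. destruct i as [|i].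
      * destruct j as [|j]; [simpl; lia|].
        specialize (H 0%nat (S j) ltac:(simpl in *; lia)). simpl in *. lia.
      * specialize (H i j ltac:(simpl in *; lia)). exact H.
    + intros H. split.
      * specialize (H 0%nat 1%nat ltac:(simpl; lia)). exact H.
      * intros i j Hij. specialize (H (S i) (S j) ltac:(simpl in *; lia)). exact H.
Qed.

Lemma is_omega_iff N l : is_omega N l = true <->
  length l = N /\ forall i j, (i < j < N)%nat -> (nth j l 0 < nth i l 0)%Z.
Proof.
  unfold is_omega. rewrite Bool.andb_true_iff, Nat.eqb_eq, strict_decr_iff.
  split; intros [<- H]; auto.
Qed.

Definition coord (l : list Z) (i : nat) : R := IZR (nth i l 0%Z).

Lemma coord_separated N l : is_omega N l = true -> separated N (coord l).
Proof.
  intros H. apply is_omega_iff in H. destruct H as [_ H].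
  assert (Hlt : forall i j, (i < j < N)%nat -> 1 <= coord l i - coord l j).
  { intros i j Hij. specialize (H i j Hij). unfold coord. rewrite <- minus_IZR.
    apply IZR_le. lia. }
  intros i j Hi Hj Hij. destruct (Nat.lt_ge_cases i j).
  - specialize (Hlt i j ltac:(lia)). rewrite Rabs_pos_eq; lra.
  - specialize (Hlt j i ltac:(lia)). rewrite Rabs_left; lra.
Qed.

Lemma length_shiftk l k d : length (shiftk l k d) = length l.
Proof. unfold shiftk. rewrite length_map, length_seq. reflexivity. Qed.

Lemma nth_shiftk l k d i : (i < length l)%nat ->
  nth i (shiftk l k d) 0%Z = if Nat.eqb i k then (nth i l 0 + d)%Z else nth i l 0%Z.
Proof.
  intros Hi. unfold shiftk.
  set (g := fun i => if Nat.eqb i k then (nth i l 0 + d)%Z else nth i l 0%Z).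
  rewrite (nth_indep _ 0%Z (g 0%nat)) by (rewrite length_map, length_seq; exact Hi).
  rewrite map_nth, seq_nth by exact Hi. reflexivity.
Qed.

Lemma vand_neq_0 N l : is_omega N l = true -> Vand l <> 0.
Proof.
  intros H. apply is_omega_iff in H. destruct H as [HN H].
  apply fprod_neq_0. intros i Hi. apply fprod_neq_0. intros j Hj.
  destruct (Nat.ltb_spec i j); [|lra].
  specialize (H i j ltac:(lia)). apply not_0_IZR. lia.
Qed.

(** Pairs avoiding [k] are unchanged. A pair formed by [k] and j is multiplied by 1 + d/(x_k - x_j),
    whichever of the two indices comes first. *)
Lemma vand_shiftk N l k d : is_omega N l = true -> (k < N)%nat ->
  Vand (shiftk l k d) / Vand l = vand_ratio N (coord l) (IZR d) k.
Proof.
  intros Hl Hk. pose proof (vand_neq_0 N l Hl) as HV.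
  pose proof (coord_separated N l Hl) as Hsep.
  apply is_omega_iff in Hl. destruct Hl as [HN _].
  set (x := coord l) in *. set (f := fun j => 1 + IZR d / (x k - x j)).
  assert (E : Vand (shiftk l k d) = Vand l * vand_ratio N x (IZR d) k);
    [|rewrite E; field; exact HV].
  (* The correction factors of the double product sit in the row i = k, collected into one inner
     product, and in the column j = k, left as one factor for each i < k. *)
  transitivity (Vand l *
    fprod N (fun i => (if (i =? k)%nat then fprod N (fun j => if (k <? j)%nat then f j else 1) else 1)
      * (if (i <? k)%nat then f i else 1))).
  - unfold Vand. rewrite length_shiftk, HN, <- fprod_mult. apply fprod_ext. intros i Hi.
    transitivity (fprod N (fun j => (if (i <? j)%nat then IZR (nth i l 0%Z - nth j l 0%Z) else 1) *
      ((if (i =? k)%nat then (if (k <? j)%nat then f j else 1) else 1) *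
       (if (j =? k)%nat then (if (i <? k)%nat then f i else 1) else 1)))).
    + apply fprod_ext. intros j Hj. rewrite !nth_shiftk by lia.
      destruct (Nat.ltb_spec i j) as [Hij|Hij].
      * rewrite !minus_IZR.
        destruct (Nat.eqb_spec i k) as [->|Hik]; destruct (Nat.eqb_spec j k) as [->|Hjk];
          try lia.
        -- destruct (Nat.ltb_spec k j); [|lia]. unfold f. rewrite plus_IZR.
           pose proof (separated_neq N x k j Hsep Hk Hj ltac:(lia)).
           change (IZR (nth k l 0%Z)) with (x k). change (IZR (nth j l 0%Z)) with (x j). field. assumption.
        -- destruct (Nat.ltb_spec i k); [|lia]. unfold f. rewrite plus_IZR.
           pose proof (separated_neq N x k i Hsep Hk Hi ltac:(lia)).
           change (IZR (nth k l 0%Z)) with (x k). change (IZR (nth i l 0%Z)) with (x i). field. assumption.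
        -- ring.
      * destruct (Nat.eqb_spec i k) as [->|Hik]; destruct (Nat.eqb_spec j k) as [->|Hjk];
          repeat (match goal with |- context [(?a <? ?b)%nat] => destruct (Nat.ltb_spec a b) end);
          try lia; ring.
    + rewrite fprod_mult. f_equal. rewrite fprod_mult. f_equal.
      * destruct (i =? k)%nat; [reflexivity|]. apply fprod_one. auto.
      * apply fprod_single, Hk.
  - f_equal. rewrite fprod_mult, fprod_single by exact Hk. rewrite <- fprod_mult.
    apply fprod_ext. intros j Hj.
    destruct (Nat.eqb_spec j k) as [->|];
      repeat (match goal with |- context [(?a <? ?b)%nat] => destruct (Nat.ltb_spec a b) end);
      try lia; unfold f; ring.
Qed.

(** A unit move can leave [Omega] only by landing on another coordinate x_j = x_k + d, and then the
    factor 1 + d/(x_k - x_j) vanishes. *)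
Lemma shiftk_exits N l k d : is_omega N l = true -> (k < N)%nat -> d = 1%Z \/ d = (-1)%Z ->
  is_omega N (shiftk l k d) = false -> vand_ratio N (coord l) (IZR d) k = 0.
Proof.
  intros Hl Hk Hd Hout. pose proof (coord_separated N l Hl) as Hsep.
  apply is_omega_iff in Hl. destruct Hl as [HN Hl].
  apply NNPP. intros Hne.
  assert (Hfac : forall j, (j < N)%nat -> j <> k -> (nth k l 0 + d)%Z <> nth j l 0%Z).
  { intros j Hj Hjk E. apply Hne. apply fprod_zero with j; [exact Hj|].
    destruct (Nat.eqb_spec j k); [contradiction|].
    pose proof (separated_neq N _ k j Hsep Hk Hj ltac:(lia)) as Hn.
    unfold coord in *. rewrite <- E, plus_IZR in *.
    field. intros E0. apply Hn. lra. }
  assert (Hin : is_omega N (shiftk l k d) = true).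
  { apply is_omega_iff. rewrite length_shiftk. split; [exact HN|]. intros i j Hij.
    rewrite !nth_shiftk by lia. pose proof (Hl i j Hij).
    destruct (Nat.eqb_spec i k) as [->|]; destruct (Nat.eqb_spec j k) as [->|]; try lia.
    - specialize (Hfac j ltac:(lia) ltac:(lia)). lia.
    - specialize (Hfac i ltac:(lia) ltac:(lia)). lia. }
  congruence.
Qed.

(* Moves leaving Omega, which have rate 0, are redirected to the starting point. *)
Definition target {N} (x : Omega N) (l : list Z) : Omega N :=
  match Bool.bool_dec (is_omega N l) true with
  | left H => exist _ l H
  | right _ => x
  end.

Lemma ext_target {N} (f : Omega N -> R) x l :
  is_omega N l = true -> ext f l = f (target x l).
Proof.
  intros H. unfold target. destruct Bool.bool_dec as [H'|]; [|contradiction].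
  unfold ext.
  (* Generalizing over the boolean and its equation frees the dependent match of [ext] for case
     analysis. *)
  assert (K : forall b (e : is_omega N l = b), b = true ->
    (match b as b0 return is_omega N l = b0 -> R with
     | true => fun H => f (exist _ l H) | false => fun _ => 0 end) e = f (exist _ l H')).
  { intros b e Hb. destruct b; [|discriminate]. f_equal. apply is_omega_irrel. reflexivity. }
  apply K, H.
Qed.

Lemma target_eq {N} (x : Omega N) l : is_omega N l = true -> proj1_sig (target x l) = l.
Proof. intros H. unfold target. destruct Bool.bool_dec; [reflexivity|contradiction]. Qed.

Lemma coefq_quadratic a b m :
  coefq a b m = IZR m ^ 2 + (Re a + Re b) * IZR m + (Re a * Re b - Im a * Im b).
Proof. unfold coefq, cmul, cadd, cofR. simpl. ring. Qed.

Lemma jump_op_flat_map {E K : Type} (G : E -> K -> list (R * E)) (L : list K) f x :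
  jump_op (fun y => flat_map (G y) L) f x =
  fold_right Rplus 0 (map (fun k => jump_op (fun y => G y k) f x) L).
Proof.
  unfold jump_op. induction L as [|k L IH]; simpl; [reflexivity|].
  rewrite <- IH. clear IH. induction (G x k) as [|p l IH]; simpl; [ring|].
  rewrite IH. ring.
Qed.

Lemma bounded_lists_finite (B : Z) (n : nat) : exists K : list (list Z),
  forall l, length l = n -> (forall a, In a l -> (Z.abs a <= B)%Z) -> In l K.
Proof.
  induction n as [|n [K IH]].
  - exists (nil :: nil). intros l Hl _. destruct l; [left; reflexivity|discriminate].
  - set (range := map (fun i => (Z.of_nat i - B)%Z) (seq 0 (Z.to_nat (2 * B + 1)))).
    exists (flat_map (fun a => map (cons a) K) range). intros l Hl Hb.
    destruct l as [|a l]; [discriminate|]. apply in_flat_map. exists a. split.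
    + specialize (Hb a (or_introl eq_refl)). unfold range. apply in_map_iff.
      exists (Z.to_nat (a + B)). split; [lia|]. apply in_seq. lia.
    + apply in_map, IH; [injection Hl; auto|]. intros b Hin. apply Hb. right. exact Hin.
Qed.

(** * The jump chain of D *)

Section Dynamics.
Context (z z' w w' : Cx) (N : nat).
Context (adm : admissible z z' w w').
Implicit Types (x : Omega N) (f : Omega N -> R).

(** The direction [d] is meant to be 1 or -1; the second branch stands for downward jumps. *)
Definition jump_rate x (k : nat) (d : Z) : R :=
  vand_ratio N (coord (proj1_sig x)) (IZR d) k *
  (if (d =? 1)%Z then coefq z z' (Z.of_nat N - 1 - nth k (proj1_sig x) 0%Z)
   else coefq w w' (nth k (proj1_sig x) 0%Z)).

Definition jump x k d : Omega N := target x (shiftk (proj1_sig x) k d).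

Definition moves x : list (R * Omega N) :=
  flat_map (fun k => (jump_rate x k 1, jump x k 1) :: (jump_rate x k (-1), jump x k (-1)) :: nil)
    (seq 0 N).

Lemma in_moves x p : In p (moves x) -> exists k d, (k < N)%nat /\ (d = 1%Z \/ d = (-1)%Z) /\
  p = (jump_rate x k d, jump x k d).
Proof.
  unfold moves. rewrite in_flat_map. intros [k [Hk Hp]]. apply in_seq in Hk.
  destruct Hp as [<-|[<-|[]]]; [exists k, 1%Z|exists k, (-1)%Z]; repeat split; auto; lia.
Qed.

Lemma jump_op_moves f x : jump_op moves f x = fsum N (fun k =>
  jump_rate x k 1 * (f (jump x k 1) - f x) + jump_rate x k (-1) * (f (jump x k (-1)) - f x)).
Proof.
  unfold moves. rewrite jump_op_flat_map. unfold fsum. f_equal. apply map_ext.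
  intros k. unfold jump_op. simpl. ring.
Qed.

Lemma jump_cases x k d : (k < N)%nat -> d = 1%Z \/ d = (-1)%Z ->
  (is_omega N (shiftk (proj1_sig x) k d) = true /\
   proj1_sig (jump x k d) = shiftk (proj1_sig x) k d) \/
  (is_omega N (shiftk (proj1_sig x) k d) = false /\ jump_rate x k d = 0 /\ jump x k d = x).
Proof.
  intros Hk Hd. destruct (is_omega N (shiftk (proj1_sig x) k d)) eqn:E.
  - left. split; [reflexivity|]. apply target_eq, E.
  - right. split; [reflexivity|]. split.
    + unfold jump_rate. rewrite (shiftk_exits N _ k d (proj2_sig x) Hk Hd E). ring.
    + unfold jump, target. destruct Bool.bool_dec; [congruence|reflexivity].
Qed.

(** Outside [Omega] the extension takes the value 0 while [target] returns the starting point; the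
    two conventions differ only where the rate is 0. *)
Lemma Dop_moves f x : Dop z z' w w' N f x = jump_op moves f x.
Proof.
  rewrite jump_op_moves. unfold Dop. apply fsum_ext. intros k Hk.
  rewrite !(vand_shiftk N) by (exact Hk || exact (proj2_sig x)).
  assert (Hstep : forall d, d = 1%Z \/ d = (-1)%Z ->
    jump_rate x k d * (ext f (shiftk (proj1_sig x) k d) - f x) =
    jump_rate x k d * (f (jump x k d) - f x)).
  { intros d Hd. destruct (jump_cases x k d Hk Hd) as [[E _]|[_ [E _]]].
    - rewrite (ext_target f x) by exact E. reflexivity.
    - rewrite E. ring. }
  rewrite <- !Hstep by auto. reflexivity.
Qed.

Lemma coefq_pos a b : (forall k, cpos (cmul (cadd a (cofR (IZR k))) (cadd b (cofR (IZR k))))) ->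
  forall m, 0 < coefq a b m.
Proof. intros H m. apply H. Qed.

Lemma jump_rate_nonneg x k d : (k < N)%nat -> d = 1%Z \/ d = (-1)%Z -> 0 <= jump_rate x k d.
Proof.
  intros Hk Hd. apply Rmult_le_pos.
  - apply vand_ratio_bounds; auto; [apply coord_separated, (proj2_sig x)|].
    destruct Hd; subst d; auto.
  - left. destruct (d =? 1)%Z; apply coefq_pos; intros m; apply adm.
Qed.

(** * Lyapunov bounds *)

Definition psi x : R := energy N (coord (proj1_sig x)).

Lemma psi_ge1 x : 1 <= psi x.
Proof. apply energy_ge1. Qed.

Lemma psi_shift x k d : (k < N)%nat ->
  is_omega N (shiftk (proj1_sig x) k d) = true ->
  psi (jump x k d) = psi x + (2 * IZR d * coord (proj1_sig x) k + IZR d ^ 2).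
Proof.
  intros Hk E. unfold psi, jump. rewrite target_eq by exact E.
  pose proof (proj2_sig x) as Hx. apply is_omega_iff in Hx. destruct Hx as [HN _].
  set (y := coord (proj1_sig x)). unfold energy.
  rewrite (fsum_ext N _ (fun i => if (i =? k)%nat then (y k + IZR d) ^ 2 else y i ^ 2)).
  - rewrite fsum_update by exact Hk. ring.
  - intros i Hi. unfold coord. rewrite nth_shiftk by lia.
    destruct (Nat.eqb_spec i k) as [->|]; [|reflexivity]. rewrite plus_IZR. reflexivity.
Qed.

(** With s the moved coordinate and psi >= 1 + s^2, the factor 3 reduces the claim to 2 s^2 + 6 d s
    + 5 >= 0, whose discriminant is negative. *)
Lemma psi_jump x k d : (k < N)%nat -> d = 1%Z \/ d = (-1)%Z -> psi x <= 3 * psi (jump x k d).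
Proof.
  intros Hk Hd. destruct (jump_cases x k d Hk Hd) as [[E _]|[_ [_ E]]].
  - rewrite psi_shift by assumption. pose proof (energy_term N (coord (proj1_sig x)) k Hk) as H.
    fold (psi x) in H. set (s := coord (proj1_sig x) k) in *.
    pose proof (pow2_ge_0 (3 * s + 2)). pose proof (pow2_ge_0 (3 * s - 2)).
    pose proof (pow2_ge_0 (s + 3)). pose proof (pow2_ge_0 (s - 3)).
    pose proof (pow2_ge_0 (s + 1)). pose proof (pow2_ge_0 (s - 1)).
    destruct Hd; subst d; nra.
  - rewrite E. pose proof (psi_ge1 x). lra.
Qed.

Lemma psi_increment x k d : (k < N)%nat -> d = 1%Z \/ d = (-1)%Z ->
  jump_rate x k d * (psi (jump x k d) - psi x) =
  jump_rate x k d * (2 * IZR d * coord (proj1_sig x) k + 1).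
Proof.
  intros Hk Hd. destruct (jump_cases x k d Hk Hd) as [[E _]|[_ [E _]]].
  - rewrite psi_shift by assumption. destruct Hd; subst d; ring.
  - rewrite E. ring.
Qed.

(** The leading coefficient is 1 in both directions, as the cancellation in [drift_bound]
    requires. *)
Lemma jump_rate_quadratic d : d = 1%Z \/ d = (-1)%Z -> exists p q, forall x k,
  jump_rate x k d = vand_ratio N (coord (proj1_sig x)) (IZR d) k *
    (coord (proj1_sig x) k ^ 2 + p * coord (proj1_sig x) k + q).
Proof.
  intros [-> | ->].
  - set (K := IZR (Z.of_nat N) - 1).
    exists (- 2 * K - (Re z + Re z')).
    exists (K ^ 2 + (Re z + Re z') * K + (Re z * Re z' - Im z * Im z')).
    intros x k. unfold jump_rate. simpl Z.eqb. cbv iota. rewrite coefq_quadratic.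
    rewrite !minus_IZR. unfold coord. fold K. f_equal. unfold K. ring.
  - exists (Re w + Re w'). exists (Re w * Re w' - Im w * Im w').
    intros x k. unfold jump_rate. simpl Z.eqb. cbv iota. rewrite coefq_quadratic. reflexivity.
Qed.

Lemma jump_op_psi_bound : exists C, 0 <= C /\ forall x, Rabs (jump_op moves psi x) <= C * psi x.
Proof.
  destruct (jump_rate_quadratic 1 ltac:(auto)) as [p1 [q1 H1]].
  destruct (jump_rate_quadratic (-1) ltac:(auto)) as [p2 [q2 H2]].
  destruct (drift_bound N p1 q1 p2 q2) as [C [HC H]].
  exists C. split; [exact HC|]. intros x. specialize (H _ (coord_separated N _ (proj2_sig x))).
  rewrite jump_op_moves.
  erewrite fsum_ext; [exact H|]. intros k Hk. cbv beta.
  rewrite !psi_increment, H1, H2 by auto. ring.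
Qed.

(** The quadratic factor of the rate and the squared increment of [psi] are each of order 1 + s^2 in
    the moved coordinate s, hence O(psi). *)
Lemma jump_square_bound : exists C, 0 <= C /\ forall x k d, (k < N)%nat -> d = 1%Z \/ d = (-1)%Z ->
  jump_rate x k d * (psi (jump x k d) - psi x) ^ 2 <= C * psi x ^ 2.
Proof.
  assert (Hone : forall d, d = 1%Z \/ d = (-1)%Z -> exists C, 0 <= C /\ forall x k, (k < N)%nat ->
    jump_rate x k d * (psi (jump x k d) - psi x) ^ 2 <= C * psi x ^ 2).
  { intros d Hd. destruct (jump_rate_quadratic d Hd) as [p [q H]].
    set (B := 1 + Rabs p + Rabs q).
    assert (HB : 0 <= B) by (unfold B; pose proof (Rabs_pos p); pose proof (Rabs_pos q); lra).
    assert (H2 : 0 < 2 ^ N) by (apply pow_lt; lra).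
    exists (2 ^ N * (B * 6)). split; [apply Rmult_le_pos; lra|].
    intros x k Hk.
    (* [psi_increment] is available only in the presence of the rate, so the two factors of the
       square are rewritten one after the other. *)
    replace (jump_rate x k d * (psi (jump x k d) - psi x) ^ 2)
      with (jump_rate x k d * (psi (jump x k d) - psi x) * (psi (jump x k d) - psi x)) by ring.
    rewrite psi_increment by assumption.
    replace (jump_rate x k d * (2 * IZR d * coord (proj1_sig x) k + 1) * (psi (jump x k d) - psi x))
      with (jump_rate x k d * (psi (jump x k d) - psi x) * (2 * IZR d * coord (proj1_sig x) k + 1))
      by ring.
    rewrite psi_increment, H by assumption.
    pose proof (energy_term N (coord (proj1_sig x)) k Hk) as He. fold (psi x) in He.
    pose proof (vand_ratio_bounds N _ (IZR d) k (coord_separated N _ (proj2_sig x)) Hk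
      ltac:(destruct Hd; subst d; auto)) as Hr.
    set (r := vand_ratio N (coord (proj1_sig x)) (IZR d) k) in *.
    set (s := coord (proj1_sig x) k) in *.
    pose proof (quadratic_bound p q s) as Hq. fold B in Hq. apply Rabs_le_bounds in Hq.
    pose proof (pow2_ge_0 s) as Hs.
    assert (Hd2 : (2 * IZR d * s + 1) ^ 2 <= 6 * psi x).
    { destruct Hd; subst d; pose proof (pow2_ge_0 (s - 1)); pose proof (pow2_ge_0 (s + 1)); nra. }
    pose proof (pow2_ge_0 (2 * IZR d * s + 1)) as Hd0.
    replace (r * (s ^ 2 + p * s + q) * (2 * IZR d * s + 1) * (2 * IZR d * s + 1))
      with (r * ((s ^ 2 + p * s + q) * (2 * IZR d * s + 1) ^ 2)) by ring.
    assert (Ha : (s ^ 2 + p * s + q) * (2 * IZR d * s + 1) ^ 2 <= (B * psi x) * (6 * psi x)).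
    { apply Rle_trans with ((B * psi x) * (2 * IZR d * s + 1) ^ 2).
      - apply Rmult_le_compat_r; [exact Hd0|].
        assert (B * (1 + s ^ 2) <= B * psi x) by (apply Rmult_le_compat_l; assumption). lra.
      - apply Rmult_le_compat_l; [apply Rmult_le_pos; lra|exact Hd2]. }
    apply Rle_trans with (r * ((B * psi x) * (6 * psi x))).
    - apply Rmult_le_compat_l; lra.
    - replace (2 ^ N * (B * 6) * psi x ^ 2) with (2 ^ N * ((B * psi x) * (6 * psi x))) by ring.
      apply Rmult_le_compat_r; [|lra]. apply Rmult_le_pos; apply Rmult_le_pos; lra. }
  destruct (Hone 1%Z ltac:(auto)) as [C1 [P1 H1]].
  destruct (Hone (-1)%Z ltac:(auto)) as [C2 [P2 H2]].
  exists (C1 + C2). split; [lra|]. intros x k d Hk Hd.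
  pose proof (pow2_ge_0 (psi x)). rewrite Rmult_plus_distr_r.
  assert (0 <= C1 * psi x ^ 2) by (apply Rmult_le_pos; assumption).
  assert (0 <= C2 * psi x ^ 2) by (apply Rmult_le_pos; assumption).
  destruct Hd; subst d; [specialize (H1 x k Hk)|specialize (H2 x k Hk)]; lra.
Qed.

(** For 1/psi, the first-order term uses the lower bound D psi >= -C1 psi and the square term uses
    [jump_square_bound]. The constant 6 is the factor 3 of [psi_jump] for each of the two
    directions. *)
Lemma lyapunov_bounds : exists c, 0 <= c /\ forall x,
  jump_op moves psi x <= c * psi x /\ jump_op moves (fun y => / psi y) x <= c * / psi x.
Proof.
  destruct jump_op_psi_bound as [C1 [HC1 H1]]. destruct jump_square_bound as [C2 [HC2 H2]].
  pose proof (pos_INR N) as HN.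
  assert (HNC : 0 <= INR N * C2) by (apply Rmult_le_pos; assumption).
  exists (C1 + 6 * (INR N * C2)). split; [lra|]. intros x.
  specialize (H1 x). apply Rabs_le_bounds in H1.
  pose proof (psi_ge1 x) as Hx. set (P := psi x) in *.
  assert (Hi : 0 < / P) by (apply Rinv_0_lt_compat; lra).
  split; [assert (0 <= INR N * C2 * P) by (apply Rmult_le_pos; lra); lra|].
  (* [1/y - 1/P = - (y - P)/P^2 + (y - P)^2/(P^2 y)] and [1/y <= 3/P]. *)
  assert (Hterm : forall k d, (k < N)%nat -> d = 1%Z \/ d = (-1)%Z ->
    jump_rate x k d * (/ psi (jump x k d) - / P) <=
    - (/ P) ^ 2 * (jump_rate x k d * (psi (jump x k d) - P)) + 3 * C2 * / P).
  { intros k d Hk Hd. pose proof (jump_rate_nonneg x k d Hk Hd) as Hr.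
    specialize (H2 x k d Hk Hd). fold P in H2.
    pose proof (psi_jump x k d Hk Hd) as Hj. fold P in Hj.
    pose proof (psi_ge1 (jump x k d)) as Hy.
    set (y := psi (jump x k d)) in *. set (r := jump_rate x k d) in *.
    assert (Hyi : 0 < / y) by (apply Rinv_0_lt_compat; lra).
    assert (Hy3 : / y <= 3 * / P).
    { apply Rmult_le_reg_l with (y * P); [apply Rmult_lt_0_compat; lra|].
      replace (y * P * / y) with P by (field; lra).
      replace (y * P * (3 * / P)) with (3 * y) by (field; lra). exact Hj. }
    replace (r * (/ y - / P))
      with (- (/ P) ^ 2 * (r * (y - P)) + (r * (y - P) ^ 2) * ((/ P) ^ 2 * / y))
      by (field; lra).
    apply Rplus_le_compat_l.
    apply Rle_trans with ((C2 * P ^ 2) * ((/ P) ^ 2 * (3 * / P))); [|right; field; lra].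
    apply Rmult_le_compat; [apply Rmult_le_pos; [exact Hr|apply pow2_ge_0]| |exact H2|].
    - apply Rmult_le_pos; [apply pow2_ge_0|lra].
    - apply Rmult_le_compat_l; [apply pow2_ge_0|exact Hy3]. }
  rewrite jump_op_moves in *.
  eapply Rle_trans.
  { apply fsum_le with (G := fun k =>
      - (/ P) ^ 2 * (jump_rate x k 1 * (psi (jump x k 1) - P)
        + jump_rate x k (-1) * (psi (jump x k (-1)) - P)) + 1 * (6 * C2 * / P)).
    intros k Hk. fold P.
    pose proof (Hterm k 1%Z Hk ltac:(auto)). pose proof (Hterm k (-1)%Z Hk ltac:(auto)). lra. }
  rewrite fsum_lin, fsum_const.
  set (S := fsum N _) in *.
  assert ((/ P) ^ 2 * - S <= (/ P) ^ 2 * (C1 * P)).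
  { apply Rmult_le_compat_l; [apply pow2_ge_0|]. lra. }
  replace ((/ P) ^ 2 * (C1 * P)) with (C1 * / P) in * by (field; lra). lra.
Qed.

Lemma psi_proper M : exists K : list (Omega N), forall x, psi x <= M -> In x K.
Proof.
  (* Every coordinate b satisfies |b| <= 1 + b^2 <= psi <= M, so the box of radius [up M] contains
     the sublevel set. *)
  destruct (bounded_lists_finite (up M) N) as [K HK].
  assert (HL : exists L : list (Omega N), forall x, In (proj1_sig x) K -> In x L).
  { clear HK. induction K as [|l K [L IH]].
    - exists nil. intros x [].
    - destruct (is_omega N l) eqn:E.
      + exists (exist _ l E :: L). intros x [Hx|Hx]; [left|right; auto].
        apply is_omega_irrel. exact Hx.
      + exists L. intros x [Hx|Hx]; [|auto]. pose proof (proj2_sig x) as H.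
        rewrite <- Hx in H. simpl in H. congruence. }
  destruct HL as [L HL]. exists L. intros x Hx. apply HL, HK.
  - pose proof (proj2_sig x) as H. apply is_omega_iff in H. apply H.
  - intros a Ha. pose proof (proj2_sig x) as H. apply is_omega_iff in H. destruct H as [HN _].
    apply (In_nth _ _ 0%Z) in Ha. destruct Ha as [k [Hk <-]].
    pose proof (energy_term N (coord (proj1_sig x)) k ltac:(lia)) as He. fold (psi x) in He.
    unfold coord in He. set (b := nth k (proj1_sig x) 0%Z) in *.
    destruct (archimed M) as [Hup _]. apply le_IZR. rewrite abs_IZR.
    pose proof (pow2_abs (IZR b)). pose proof (pow2_ge_0 (Rabs (IZR b) - 1)).
    pose proof (Rabs_pos (IZR b)). nra.
Qed.

End Dynamics.

Theorem theorem5 (z z' w w' : Cx) (N : nat) :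
  admissible z z' w w' -> (1 <= N)%nat ->
  exists (p : R -> Omega N -> Omega N -> R)
         (T : R -> (Omega N -> R) -> (Omega N -> R)),
    feller_semigroup p T /\
    (forall f g : Omega N -> R,
       generator T f g <->
       (C0 f /\ C0 (Dop z z' w w' N f) /\ forall x, g x = Dop z z' w w' N f x)).
Proof.
  intros adm _.
  destruct (lyapunov_bounds z z' w w' N adm) as [c [Hc Hlyap]].
  set (Q := moves z z' w w' N) in *.
  exists (kernel Q c), (semigroup Q c).
  assert (ED : Dop z z' w w' N = jump_op Q).
  { extensionality f. extensionality x. apply Dop_moves. }
  rewrite ED. apply lyapunov_feller with (psi := psi N) (a := 3).
  - intros x p Hp. apply in_moves in Hp. destruct Hp as [k [d [Hk [Hd ->]]]].
    apply jump_rate_nonneg; assumption.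
  - apply psi_ge1.
  - apply psi_proper.
  - exact Hc.
  - intros x. apply Hlyap.
  - intros x. apply Hlyap.
  - intros x p Hp. apply in_moves in Hp. destruct Hp as [k [d [Hk [Hd ->]]]].
    apply psi_jump; assumption.
Qed.
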